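(* Let $X$ be a compact metric space and let $P:C(X)\to C(X)$ be a Markov operator. Let $(\phi_n)_{n\ge1}$ be a $P$-subadditive sequence of upper semicontinuous functions $\phi_n:X\to[-\infty,\infty)$. Let $\mathcal I$ be the set of $P^*$-invariant probability measures, $\mathcal I_{\rm erg}\subset\mathcal I$ the set of ergodic ones, and for $\mu\in\mathcal I$ let $$\Lambda(\mu)=\lim_{n\to\infty}\frac1n\int\phi_n\,d\mu=\inf_{n\ge1}\frac1n\int\phi_n\,d\mu\in[-\infty,\infty),\qquad \Lambda=\sup_{\mu\in\mathcal I}\Lambda(\mu).$$ Then $$\Lambda=\lim_{n\to\infty}\max_{x\in X}\frac1n\phi_n(x).\qquad( * )$$ Moreover, (i) $\displaystyle\Lambda=\max\{\Lambda(\mu):\mu\in\mathcal I_{\rm erg}\}$; (ii) $\displaystyle\Lambda=\sup_{x\in X}\limsup_{n\to\infty}\frac1n\phi_n(x)=\sup_{\mu\in\mathcal I}\int\limsup_{n\to\infty}\frac1n\phi_n(x)\,d\mu$; (iii) $\displaystyle\Lambda=\lim_{n\to\infty}\sup_{\mu\in\mathcal I}\frac1n\int\phi_n\,d\mu\le\max_{\mu\in\mathcal I_{\rm erg}}\frac1m\int\phi_m\,d\mu$ for all $m\ge1$. In $( * )$ and in (iii), the limit $\lim_{n\to\infty}$ may be replaced by the infimum $\inf_{n\ge1}$.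
   Context: A linear operator $P:C(X)\to C(X)$ is a Markov operator if $P\varphi\ge0$ whenever $\varphi\ge0$ and $P1_X=1_X$. It extends to upper semicontinuous functions $f:X\to[-\infty,\infty)$ by $Pf=\inf\{Pg:g\in C(X),\ f\le g\}$ (equivalently $Pf(x)=\int f\,d(P^*\delta_x)$). The dual $P^*$ acts on probability measures by $\int P\phi\,d\mu=\int\phi\,dP^*\mu$; $\mu$ is $P^*$-invariant if $P^*\mu=\mu$. The ergodic measures are the extreme points of the convex set $\mathcal I$. A sequence $(\phi_n)_{n\ge1}$ is $P$-subadditive if $\phi_{n+m}\le\phi_n+P^n\phi_m$ for all $m,n\ge1$. *)

(* Defs.v *)
From HB Require Import structures.
From mathcomp Require Import all_boot all_order all_algebra.
From mathcomp Require Import all_classical all_reals all_analysis.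

Set Implicit Arguments.
Unset Strict Implicit.
Unset Printing Implicit Defensive.

Import Order.TTheory GRing.Theory Num.Theory.
Import numFieldNormedType.Exports.

Local Open Scope classical_set_scope.
Local Open Scope ring_scope.

(* Measurable types are pointed in the library, so the metric spaces carrying
   Borel measures are pointed too; the base point only witnesses nonemptiness. *)
#[short(type="pmetricType")]
HB.structure Definition PointedMetric (K : numDomainType) :=
  { M of Metric K M & Pointed M }.

Section continuous_lmodule.
Context {X : topologicalType} {R : realType}.
Implicit Types (f g h : continuousType X R) (a b : R).

Lemma cfun_add_cts f g : continuous (fun x => f x + g x).
Proof. by move=> x; apply: cvgD; exact: cts_fun. Qed.

Lemma cfun_opp_cts f : continuous (fun x => - f x).
Proof. by move=> x; apply: cvgN; exact: cts_fun. Qed.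

Lemma cfun_scale_cts a f : continuous (fun x => a * f x).
Proof. by move=> x; apply: cvgM; [exact: cvg_cst|exact: cts_fun]. Qed.

Definition cfun_zero : continuousType X R := cst 0.
Definition cfun_add f g : continuousType X R := mkcts (@cfun_add_cts f g).
Definition cfun_opp f : continuousType X R := mkcts (@cfun_opp_cts f).
Definition cfun_scale a f : continuousType X R := mkcts (@cfun_scale_cts a f).

Lemma cfun_addA : associative cfun_add.
Proof. by move=> f g h; apply/continuousEP => x; exact: addrA. Qed.

Lemma cfun_addC : commutative cfun_add.
Proof. by move=> f g; apply/continuousEP => x; exact: addrC. Qed.

Lemma cfun_add0 : left_id cfun_zero cfun_add.
Proof. by move=> f; apply/continuousEP => x; exact: add0r. Qed.

Lemma cfun_addN : left_inverse cfun_zero cfun_opp cfun_add.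
Proof. by move=> f; apply/continuousEP => x; exact: addNr. Qed.

HB.instance Definition _ := GRing.isZmodule.Build (continuousType X R)
  cfun_addA cfun_addC cfun_add0 cfun_addN.

Lemma cfun_scaleA a b f : cfun_scale a (cfun_scale b f) = cfun_scale (a * b) f.
Proof. by apply/continuousEP => x; exact: mulrA. Qed.

Lemma cfun_scale1 : left_id 1 cfun_scale.
Proof. by move=> f; apply/continuousEP => x; exact: mul1r. Qed.

Lemma cfun_scaleDr : right_distributive cfun_scale +%R.
Proof. by move=> a f g; apply/continuousEP => x; exact: mulrDr. Qed.

Lemma cfun_scaleDl f : {morph cfun_scale^~ f : a b / a + b}.
Proof. by move=> a b; apply/continuousEP => x; exact: mulrDl. Qed.

HB.instance Definition _ := GRing.Zmodule_isLmodule.Build R (continuousType X R)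
  cfun_scaleA cfun_scale1 cfun_scaleDr cfun_scaleDl.

End continuous_lmodule.

Notation borel X := (g_sigma_algebraType (@open X)).

Section defs.
Local Open Scope ereal_scope.
Context {R : realType} {X : pmetricType R}.
Implicit Types (P : {linear continuousType X R -> continuousType X R}).
Implicit Types (f : X -> \bar R) (phi : nat -> X -> \bar R).
Implicit Types (mu nu : probability (borel X) R) (S : set (\bar R)).

Definition is_markov P : Prop :=
  (forall g : continuousType X R,
     (forall x, 0 <= g x)%R -> forall x, (0 <= P g x)%R) /\
  P (cst 1%R) = cst 1%R.

Definition upper_semicontinuous f : Prop :=
  forall x (a : R), f x < a%:E -> \forall y \near x, f y < a%:E.

Definition markov_ext P f : X -> \bar R := fun x =>
  ereal_inf [set (P g x)%:E |
             g in [set g : continuousType X R | forall y, f y <= (g y)%:E]].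

Definition subadditive_seq P phi : Prop :=
  forall n m, (0 < n)%N -> (0 < m)%N ->
  forall x, phi (n + m)%N x <= phi n x + iter n (markov_ext P) (phi m) x.

(* The graph of the dual operator: "P^* mu = nu"; such a nu is unique on Borel
   sets. *)
Definition is_dual P mu nu : Prop := forall g : continuousType X R,
  \int[mu]_x (P g x)%:E = \int[nu]_x (g x)%:E.

Definition invariant_proba P : set (probability (borel X) R) :=
  [set mu | is_dual P mu mu].

(* Measures are total functions on sets, with unspecified values on
   non-measurable ones, so they are compared on Borel sets only. *)
Definition ergodic_proba P : set (probability (borel X) R) :=
  [set mu | invariant_proba P mu /\
    forall (mu1 mu2 : probability (borel X) R) (t : R),
      invariant_proba P mu1 -> invariant_proba P mu2 -> (0 < t < 1)%R ->
      (forall A : set (borel X), measurable A ->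
         mu A = t%:E * mu1 A + (1 - t)%:E * mu2 A) ->
      forall A : set (borel X), measurable A -> mu1 A = mu A /\ mu2 A = mu A].

Definition avg phi (n : nat) (x : X) : \bar R := (n%:R^-1)%:E * phi n x.

Definition int_avg phi mu (n : nat) : \bar R :=
  (n%:R^-1)%:E * \int[mu]_x phi n x.

Definition lyapunov phi mu : \bar R := limn (int_avg phi mu).

Definition max_lyapunov P phi : \bar R :=
  ereal_sup [set lyapunov phi mu | mu in invariant_proba P].

(* S has a greatest element, which is then [ereal_sup S]. *)
Definition has_max S : Prop := S (ereal_sup S).

Definition inf_pos (u : nat -> \bar R) : \bar R :=
  ereal_inf [set u n | n in [set n | (0 < n)%N]].

End defs.

(* Main.v *)
Require Import Defs.
From HB Require Import structures.
From mathcomp Require Import all_boot all_order all_algebra.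
From mathcomp Require Import all_classical all_reals all_analysis.
From mathcomp Require Import measurable_realfun ring lra.
Import Order.TTheory GRing.Theory Num.Theory.
Import numFieldNormedType.Exports.
Local Open Scope classical_set_scope.
Local Open Scope ring_scope.
Local Open Scope ereal_scope.

(* Let M_n = max phi_n, attained at y_n; it is subadditive, so by Fekete M_n/n
   tends to l = inf M_n/n, and Lambda(mu) <= l for every invariant mu.
   Conversely, the positive functionals g |-> (1/n) sum_(t < n) P^t g (y_n)
   converge along an ultrafilter to a P-invariant one, hence (Riesz-Markov) to
   an invariant measure mu. If g is continuous and g >= phi_m, averaging the
   subadditivity relations over the m residues gives
   m phi_n <= sum_(t < n) P^t g + O(1), so the integral of g is at least m l; taking the infimum over g, Lambda(mu) >= l. Parts (ii) and (iii)
   follow by squeezing, with the reverse Fatou lemma for (ii). The maxima over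
   ergodic measures come from Bauer's principle: an upper semicontinuous affine
   functional attains its maximum over the invariant measures at an extreme
   point. Weak compactness is used only in the form of ultrafilter limits. *)

(** * Extended real sequences *)

(** The obstacle is the value [-oo]: each [phi n] may take it, even everywhere, and so may its
    integrals. Semicontinuous functions are therefore reached through continuous majorants, their
    integrals through [M - f >= 0], and inequalities between extended reals through real levels
    strictly above. The extension of [P] enters the same way: if [g] is continuous and [g >= phi m],
    then [phi (n + m) <= phi n + P^n g], so no transition kernel is ever built. The residue
    averaging is a sliding window: shifting a sum of [m] consecutive terms [phi n x] by one index
    adds [phi (n + m) x - phi n x], at most [P^n g x], and these increments add up along the orbit.
    The error is uniform in the base point, as it must be because [y_n] moves with [n]. The limit
    measure has no reason to be ergodic, hence the appeal to Bauer's principle, for [Lambda] in (i)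
    and for each [m] in (iii). *)

Lemma lte_dense_fin {R : realType} (u v : \bar R) : u < v ->
  exists a : R, u < a%:E /\ a%:E < v.
Proof.
case: u v => [r| |] [s| |] //=.
- rewrite lte_fin => rs; exists ((r + s) / 2)%R.
  by rewrite !lte_fin midf_lt ?midf_lt//; split.
- by move=> _; exists (r + 1)%R; rewrite lte_fin ltrDl ltry.
- by move=> _; exists (s - 1)%R; rewrite lte_fin gtrDl ltrN10 ltNyr.
- by move=> _; exists 0%R; rewrite ltNyr ltry.
Qed.

(** Convergence to an infimum: with [l] an eventual lower bound, only real levels above [l] remain
    to be tested, and [l = -oo] is included. *)
Lemma cvge_from_above {R : realType} (T : Type) (F : set_system T) (f : T -> \bar R)
    (l : \bar R) : Filter F -> l < +oo -> (\forall t \near F, l <= f t) ->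
  (forall c : R, l < c%:E -> \forall t \near F, f t <= c%:E) ->
  f t @[t --> F] --> l.
Proof.
move=> FF; case: l => [r| |] // _ lf fl; last first.
  by apply/cvgeNyPle => c; apply: fl; rewrite ltNyr.
apply/fine_cvgP; split.
  have r1 : r%:E < (r + 1)%:E by rewrite lte_fin ltrDl.
  near=> t; rewrite fin_numElt; apply/andP; split.
    by rewrite (@lt_le_trans _ _ r%:E) ?ltNyr//; near: t.
  by rewrite (@le_lt_trans _ _ (r + 1)%:E) ?ltry//; near: t; exact: fl.
apply/cvgrPdist_le => e e0.
have re : r%:E < (r + e)%:E by rewrite lte_fin ltrDl.
near=> t; rewrite /=; have : r%:E <= f t by near: t.
have : f t <= (r + e)%:E by near: t; exact: fl.
case: (f t) => [s| |]//=; rewrite !lee_fin => sre rs.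
by rewrite ler_norml; apply/andP; split; lra.
Unshelve. all: by end_near. Qed.

Lemma lee_dense {R : realType} (u v : \bar R) :
  (forall c : R, v < c%:E -> u <= c%:E) -> u <= v.
Proof.
move=> uv; rewrite leNgt; apply/negP => /lte_dense_fin[c [vc cu]].
by have := uv c vc; rewrite leNgt cu.
Qed.

(** Serves for sums of integrals that may be [-oo] and are only known through real numbers above
    them. *)
Lemma lee_addP {R : realType} (u v w : \bar R) : u < +oo -> v < +oo ->
  (forall a b : R, u < a%:E -> v < b%:E -> w <= (a + b)%:E) -> w <= u + v.
Proof.
move=> u_lty v_lty uvw; apply: lee_dense => c.
move: u v u_lty v_lty uvw => [p| |] [q| |]// _ _ uvw.
- rewrite -EFinD lte_fin => pqc.
  rewrite (_ : c = (p + (c - p - q) / 2 + (q + (c - p - q) / 2))%R); last by field.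
  by apply: uvw; rewrite lte_fin ltrDl divr_gt0// -addrA -opprD subr_gt0.
- move=> _; rewrite (_ : c = (p + 1 + (c - p - 1))%R); last by ring.
  by apply: uvw; rewrite ?ltNyr// lte_fin ltrDl.
- move=> _; rewrite (_ : c = (c - q - 1 + (q + 1))%R); last by ring.
  by apply: uvw; rewrite ?ltNyr// lte_fin ltrDl.
- by move=> _; rewrite -[c]add0r; apply: uvw; rewrite ltNyr.
Qed.

Lemma ereal_sup_max {R : realType} (S : set (\bar R)) s : S s -> ubound S s ->
  ereal_sup S = s.
Proof.
move=> Ss Sub; apply/eqP; rewrite eq_le ge_ereal_sup//=.
exact: ereal_sup_ubound.
Qed.

Lemma limn_esup_le {R : realType} (u : nat -> \bar R) (l : \bar R) :
  (forall c : R, l < c%:E -> \forall n \near \oo, u n <= c%:E) ->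
  limn_esup u <= l.
Proof.
move=> ul; apply: lee_dense => c /ul[N _ uN].
have -> : limn_esup u = ereal_inf (range (esups u)).
  by rewrite limn_esup_lim; apply/cvg_lim => //; exact: cvg_esups_inf.
apply: (@le_trans _ _ (esups u N)); first by apply: ereal_inf_lbound; exists N.
by apply: ge_ereal_sup => _ [n Nn <-]; exact: uN.
Qed.

(** * Semicontinuous functions *)

Section continuous_functions.
Context {R : realType} {X : pmetricType R}.
Local Notation C := (continuousType X R).
Hypothesis X_compact : compact [set: X].

Lemma lipschitz_continuous (h : X -> R) (k : R) :
  (forall x y, h x <= h y + k * mdist x y)%R -> continuous h.
Proof.
move=> hk x; apply/cvgrPdist_lt => e e0.
have k0 : (0 < `|k| + 1)%R by rewrite ltr_wpDl.
have kd y : (k * mdist x y <= (`|k| + 1) * mdist x y)%R.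
  by rewrite ler_wpM2r ?mdist_ge0// (le_trans (ler_norm _))// lerDl.
near=> y.
have xy : (mdist x y < e / (`|k| + 1))%R.
  have : ball x (e / (`|k| + 1))%R y.
    by near: y; apply: nbhsx_ballx; rewrite divr_gt0.
  by rewrite ballEmdist.
rewrite ltr_pdivlMr// mulrC in xy.
have := hk x y; have := hk y x; rewrite metric_sym.
have := kd y.
by rewrite ltr_norml => *; apply/andP; split; lra.
Unshelve. all: by end_near. Qed.

Lemma cfun_bounded (g : C) : exists2 M, (0 <= M)%R & forall x, (`|g x| <= M)%R.
Proof.
have /compact_bounded[M [_ /(_ (`|M| + 1)%R)]] :
    compact (g @` [set: X]).
  apply: continuous_compact => //.
  by apply: continuous_subspaceT; exact: cts_fun.
rewrite (le_lt_trans (ler_norm _)) ?ltrDl// => /(_ isT) gM.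
by exists (`|M| + 1)%R => [|x]; [rewrite addr_ge0|apply: gM; exists x].
Qed.

(** A negative value persists at later indices by monotonicity and at nearby points by continuity;
    compactness makes the index uniform. *)
Lemma dini (u : nat -> C) :
  (forall x, {homo u ^~ x : m n / (m <= n)%N >-> (n <= m)%R}) ->
  (forall x, exists n, (u n x < 0)%R) ->
  exists n, forall x, (u n x < 0)%R.
Proof.
move=> u_dec u_neg.
have /compact_near_coveringP/(_ _ \oo (fun n x => (u n x < 0)%R) _) := X_compact.
case=> [x _|N _ uN].
  have [n unx] := u_neg x.
  near=> y m => /=; apply: (@le_lt_trans _ _ (u n y)).
    by apply: u_dec; near: m; exists n.
  by near: y; apply: (cvgr_lt (u n x)) => //; exact: cts_fun.
by exists N => x; apply: uN => /=.
Unshelve. all: by end_near. Qed.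

(** Sup-convolution: [h n x] is the supremum over [y] of [max (f y) (-n) - n d(x, y)]. It is
    [n]-Lipschitz, and the truncation and the penalty both make it decrease in [n]. The bound [|M|],
    independent of [n], is what the convergence of integrals requires. *)
Lemma usc_approx (f : X -> \bar R) (M : R) :
  upper_semicontinuous f -> (forall x, f x <= M%:E) ->
  exists g : nat -> C, [/\ forall n x, f x <= (g n x)%:E,
    forall x, {homo g ^~ x : m n / (m <= n)%N >-> (n <= m)%R},
    forall x, (g n x)%:E @[n --> \oo] --> f x &
    forall n x, (g n x <= `|M|)%R].
Proof.
move=> f_usc fM.
pose F n y : R := fine (maxe (f y) (- n%:R)%:E).
have FE n y : (F n y)%:E = maxe (f y) (- n%:R)%:E.
  rewrite fineK// fin_numE; apply/andP; split.
    by rewrite -ltNye lt_max ltNyr orbT.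
  by rewrite -ltey gt_max ltry (le_lt_trans (fM y)) ?ltry.
have FM n y : (F n y <= `|M|)%R.
  rewrite -lee_fin FE ge_max (le_trans (fM y)) ?lee_fin ?ler_norm//=.
  by rewrite (@le_trans _ _ 0%R)// oppr_le0.
pose S n x := [set (F n y - n%:R * mdist x y)%R | y in [set: X]].
have S0 n x : S n x !=set0 by exists (F n x - n%:R * mdist x x)%R, x.
have SM n x : ubound (S n x) `|M|%R.
  move=> _ [y _ <-]; rewrite (le_trans _ (FM n y))// gerBl.
  by rewrite mulr_ge0// mdist_ge0.
have Sb n x : has_ubound (S n x) by exists `|M|%R.
pose h n x := sup (S n x).
have Sh n x y : (F n y - n%:R * mdist x y <= h n x)%R.
  by apply: ub_le_sup => //; exists y.
have h_lip n x y : (h n x <= h n y + n%:R * mdist x y)%R.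
  apply: ge_sup => // _ [z _ <-].
  have := Sh n y z; have := metric_triangle y x z.
  move/(ler_wpM2l (ler0n R n)); rewrite mulrDr (metric_sym y x); lra.
pose g n : C := mkcts (lipschitz_continuous (h n) n%:R (h_lip n)).
have fF n y : f y <= (F n y)%:E by rewrite FE le_max lexx.
have fg n x : f x <= (g n x)%:E.
  rewrite (le_trans (fF n x))// lee_fin.
  by have := Sh n x x; rewrite mdistxx mulr0 subr0.
have g_dec x : {homo g ^~ x : m n / (m <= n)%N >-> (n <= m)%R}.
  move=> m n mn; apply: ge_sup => // _ [y _ <-].
  apply: le_trans (Sh m x y); apply: lerB; last first.
    by rewrite ler_wpM2r ?mdist_ge0// ler_nat.
  rewrite -lee_fin !FE ge_max le_max lexx/= le_max.
  by rewrite lee_fin lerN2 ler_nat mn orbT.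
exists g; split => //; last first.
  by move=> n x; apply: ge_sup.
move=> x.
have -> : f x = ereal_inf (range (fun n => (g n x)%:E)).
  apply/eqP; rewrite eq_le; apply/andP; split.
    by apply: le_ereal_inf_tmp => _ [n _ <-].
  rewrite leNgt; apply/negP => /lte_dense_fin[a [fxa]]; apply/negP; rewrite -leNgt.
  have /nbhs_ballP[r /= r0 fr] := f_usc x a fxa.
  (* In the ball, where [f < a], the supremum is at most [a] because [- N <= a]; outside it, the
     penalty leaves at most [|M| - N r <= a]. *)
  pose N := (Num.truncn `|a| + Num.truncn ((`|M| + `|a|) / r)).+1.
  have N1 : (`|a| <= N%:R)%R.
    rewrite (le_trans (ltW (truncnS_gt _)))// ler_nat ltnS leq_addr//.
  have N2 : (`|M| + `|a| <= N%:R * r)%R.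
    rewrite -ler_pdivrMr// (le_trans (ltW (truncnS_gt _)))//.
    by rewrite ler_nat ltnS leq_addl.
  apply: (@le_trans _ _ (g N x)%:E); first by apply: ereal_inf_lbound; exists N.
  rewrite lee_fin; apply: ge_sup => // _ [y _ <-].
  have [xy|xy] := ltP (mdist x y) r.
    have : (F N y <= a)%R.
      rewrite -lee_fin FE ge_max; apply/andP; split.
        by apply/ltW/fr; rewrite /= ballEmdist.
      by rewrite lee_fin; have := ler_norm (- a)%R; rewrite normrN; lra.
    have : (0 <= N%:R * mdist x y)%R by rewrite mulr_ge0// mdist_ge0.
    lra.
  have := ler_wpM2l (ler0n R N) xy; have := FM N y.
  have := ler_norm (- a)%R; rewrite normrN; lra.
apply: ereal_nonincreasing_cvgn => m n mn.
by rewrite lee_fin; exact: g_dec.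
Unshelve. all: by end_near. Qed.

End continuous_functions.
(** An ultrafilter in place of a maximizing sequence: the superlevel sets of [F] within [A] are
    nested, so they generate a proper filter. *)
Lemma ereal_sup_ultra {R : realType} (T : Type) (A : set T) (F : T -> \bar R) :
  A !=set0 -> exists U : set_system T, [/\ UltraFilter U, U A &
    forall a, a < ereal_sup (F @` A) -> U [set t | a < F t]].
Proof.
move=> [t0 At0].
pose B t := [set s | A s /\ F t <= F s].
have FB : Filter (filter_from A B).
  apply: filter_from_filter; first by exists t0.
  move=> s t As At; have [st|/ltW ts] := leP (F s) (F t).
    by exists t => // r [Ar tr]; split; split => //; exact: le_trans tr.
  by exists s => // r [Ar tr]; split; split => //; exact: le_trans tr.
have PFB : ProperFilter (filter_from A B).
  by apply: filter_from_proper => t At; exists t; split.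
have [U [UU BU]] := ultraFilterLemma PFB; exists U; split => //.
  by apply: BU; exists t0 => // s [].
move=> a /ereal_sup_gt[_ [t At <-]] aFt; apply: BU.
by exists t => // s [_]; exact: lt_le_trans.
Qed.

Lemma usc_has_max {R : realType} {X : pmetricType R} (f : X -> \bar R) :
  compact [set: X] -> upper_semicontinuous f -> has_max (f @` [set: X]).
Proof.
move=> X_compact f_usc.
have [U [UU UT Uf]] := ereal_sup_ultra X setT f (ex_intro _ point I).
have [x [_ Ux]] : [set: X] `&` [set p | U --> p] !=set0.
  by move: X_compact; rewrite compact_ultra; exact.
exists x => //; apply/eqP; rewrite eq_le ereal_sup_ubound/=; last by exists x.
rewrite leNgt; apply/negP => /lte_dense_fin[a [fxa /Uf Ua]].
have /Ux Ufa := f_usc x a fxa.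
have [y [/= fya]] := filter_ex (filterI Ufa Ua).
by rewrite ltNge (ltW fya).
Qed.

(** * Sliding windows and Fekete's lemma *)

Section subadditive_sequences.
Context {R : realType}.
Implicit Types (a u : nat -> \bar R) (b : nat -> R).

(* The window sums [a (n + 1) + ... + a (n + m)] increase by at most [b (n + 1)]
   at each step, and each of their terms dominates [a (n + m + 1)] up to [D]. *)
Lemma window_sum_bound m (D B : R) : (0 < m)%N -> exists K : R, forall a b,
  (forall n, a (n.+1 + m)%N <= a n.+1 + (b n.+1)%:E) ->
  (forall n r, (r <= m)%N -> a (n.+1 + r)%N <= a n.+1 + D%:E) ->
  a 1%N <= D%:E -> (forall n, `|b n| <= B)%R ->
  forall n, (m < n)%N -> m%:R%:E * a n <= (K + \sum_(0 <= t < n) b t)%:E.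
Proof.
(* The three terms bound the first window, the cost of replacing every term of a window by the one
   just after it, and the [m + 1] values of [b] ([b 0] and the last [m]) that the added increments
   miss. *)
move=> m0; exists (m%:R * (D + D) + m%:R * D + (m.+1)%:R * B)%R.
move=> a b am ar a1 bB.
pose A n := \sum_(i < m) a (n.+1 + i)%N.
have AS n : A n.+1 <= A n + (b n.+1)%:E.
  rewrite /A; case: m m0 am {ar A} => // m _ am.
  rewrite big_ord_recr/= [in leRHS]big_ord_recl/= addn0.
  rewrite [leLHS]addeC [leRHS]addeAC; apply: leeD.
    by have := am n; rewrite addnS addSn.
  by apply: lee_sum => i _; rewrite /bump /= add1n addSnnS.
have D0 n : (n.+1 <= m)%N -> a n.+1 <= (D + D)%:E.
  move=> nm; rewrite -add1n (le_trans (ar 0%N n _))//; first exact: ltnW.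
  by rewrite EFinD leeD.
have A0 : A 0%N <= (m%:R * (D + D))%:E.
  rewrite /A (@le_trans _ _ (\sum_(i < m) (D + D)%:E))//.
    by apply: lee_sum => i _; rewrite D0.
  by rewrite sumEFin lee_fin sumr_const card_ord mulr_natl.
have An n : A n <= (m%:R * (D + D) + \sum_(0 <= t < n) b t.+1)%:E.
  elim: n => [|n IH]; first by rewrite big_geq// addr0.
  by rewrite (le_trans (AS n))// big_nat_recr//= addrA EFinD leeD.
move=> n mn; rewrite -(subnK mn) addnS -addSn; set k := (n - m.+1)%N.
have aA : m%:R%:E * a (k.+1 + m)%N <= A k + (m%:R * D)%:E.
  have -> : (m%:R * D)%:E = \sum_(i < m) D%:E.
    by rewrite sumEFin sumr_const card_ord mulr_natl.
  have -> : m%:R%:E * a (k.+1 + m)%N = \sum_(i < m) a (k.+1 + m)%N.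
    by rewrite mule_natl sumr_const card_ord.
  rewrite -big_split/=; apply: lee_sum => i _.
  have := ar (k + i)%N (m - i)%N (leq_subr _ _).
  by rewrite -!addSn -addnA subnKC// ltnW.
rewrite (le_trans aA)// (le_trans (leeD2r _ (An k)))// lee_fin.
have tail : (- (m%:R * B) <= \sum_(k <= t < k + m) b t.+1)%R.
  rewrite -mulrN -[X in X%:R](addKn k) mulr_natl -sumr_const_nat.
  by apply: ler_sum => t _; move: (bB t.+1); rewrite ler_norml => /andP[].
have -> : (k.+1 + m = (k + m).+1)%N by rewrite addSn.
rewrite big_nat_recl//= (big_cat_nat _ (leq_addr m k))//= -natr1.
by move: (bB 0%N) tail; rewrite ler_norml => /andP[]; lra.
Qed.

(** The window bound with [b] constant, equal to [m c'] where [u m < m c'], gives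
    [m u n <= K + n m c']; any [c > c'] then absorbs [K] for large [n]. *)
Lemma fekete u : (forall n, (0 < n)%N -> u n < +oo) ->
  (forall n m, (0 < n)%N -> (0 < m)%N -> u (n + m)%N <= u n + u m) ->
  (n%:R^-1)%:E * u n @[n --> \oo] --> inf_pos (fun n => (n%:R^-1)%:E * u n).
Proof.
move=> u_lty u_sub; set l := inf_pos _.
have lu n : (0 < n)%N -> l <= (n%:R^-1)%:E * u n.
  by move=> n0; apply: ereal_inf_lbound; exists n.
have ul (c : R) : l < c%:E -> \forall n \near \oo, (n%:R^-1)%:E * u n <= c%:E.
  move=> lc; have [c' [lc' cc']] := lte_dense_fin _ _ lc; rewrite lte_fin in cc'.
  have [_ [m m0 <-]] := ereal_inf_lt lc'.
  rewrite lte_pdivrMl ?ltr0n// -EFinM => umc.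
  (* A real bound for [u 1, ..., u m]; a value [-oo] contributes [0], since [fine -oo = 0]. *)
  pose D := (\sum_(i < m.+1) `|fine (u i)|)%R.
  have uD r : (0 < r)%N -> (r <= m)%N -> u r <= D%:E.
    move=> r0 rm; apply: (@le_trans _ _ (`|fine (u r)|)%:E).
      case: (u r) (u_lty r r0) => [x _|//|_]/=; last by rewrite leNye.
      by rewrite lee_fin ler_norm.
    rewrite lee_fin /D (bigD1 (inord r : 'I_m.+1))//= inordK// lerDl.
    by apply: sumr_ge0 => i _.
  have D0 : (0 <= D)%R by apply: sumr_ge0.
  have [K mK] := window_sum_bound m D (`|m%:R * c'|)%R m0.
  have {}mK n : (m < n)%N ->
      m%:R%:E * u n <= (K + \sum_(0 <= t < n) (m%:R * c'))%:E.
    apply: mK => [{}n|{}n r rm||//].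
    - by rewrite (le_trans (u_sub _ _ _ _))// leeD2l// ltW.
    - case: r rm => [_|r rm]; first by rewrite addn0 leeDl ?lee_fin.
      by rewrite (le_trans (u_sub _ _ _ _))// leeD2l// uD.
    - exact: uD.
  near=> n; have n0 : (0 < n)%N by near: n; exists 1%N.
  have mn : (m < n)%N by near: n; exists m.+1.
  have /mK := mn.
  rewrite sumr_const_nat subn0 => muK.
  have Kn : (K <= n%:R * (m%:R * (c - c')))%R.
    rewrite -ler_pdivrMr ?mulr_gt0 ?ltr0n ?subr_gt0//.
    by near: n; exact: nbhs_infty_ger.
  rewrite lee_pdivrMl ?ltr0n// -(@lee_pmul2l _ m%:R%:E) ?lte_fin ?ltr0n//.
  rewrite (le_trans muK)// -!EFinM lee_fin -mulr_natl; lra.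
have l_lty : l < +oo.
  rewrite (le_lt_trans (lu 1%N _))// invr1 mul1e; exact: u_lty.
apply: cvge_from_above => //; first by near=> n; apply: lu; near: n; exists 1%N.

Unshelve. all: by end_near. Qed.

End subadditive_sequences.

(** * Integrals of functions bounded above *)

Section integral_bounded_above.
Context d (T : measurableType d) {R : realType}.
Implicit Types (mu : probability T R) (f g : T -> \bar R) (M : R).

Let measurable_subM f M : measurable_fun [set: T] f ->
  measurable_fun [set: T] (fun x => M%:E - f x).
Proof. by move=> mf; apply: emeasurable_funB. Qed.

Let subM_ge0 f M : (forall x, f x <= M%:E) -> forall x, 0 <= M%:E - f x.
Proof. by move=> fM x; rewrite subre_ge0. Qed.

(* Valid even if the integral is [-oo]. *)
Lemma integral_subM mu f M : (0 <= M)%R -> measurable_fun [set: T] f ->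
  (forall x, f x <= M%:E) ->
  \int[mu]_x f x = M%:E - \int[mu]_x (M%:E - f x).
Proof.
move=> M0 mf fM.
have mfp := measurable_funepos mf; have mfn := measurable_funeneg mf.
have int_cst : \int[mu]_x M%:E = M%:E.
  by rewrite integral_cst//= probability_setT mule1.
(* Both sides are sums of nonnegative functions, so the integrals split even if that of [f^\-] is
   infinite; that of [f^\+] is at most [M] and can be cancelled. *)
have : \int[mu]_x (M%:E + f^\- x) = \int[mu]_x ((M%:E - f x) + f^\+ x).
  apply: eq_integral => x _; rewrite funeposE funenegE.
  case: (f x) (fM x) => [r _| //|_] /=.
    rewrite -!EFin_max -!EFinD; congr EFin.
    by rewrite !maxEle; case: ifPn; case: ifPn; lra.
  by rewrite maxNye maxye.
rewrite ge0_integralD//.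
rewrite ge0_integralD//; [|by move=> x _; exact: subM_ge0|exact: measurable_subM].
rewrite int_cst [in X in _ -> X = _]integralE.
have : \int[mu]_x f^\+ x <= M%:E.
  rewrite -[leRHS]int_cst; apply: ge0_le_integral => //.
  by move=> x _; rewrite funeposE ge_max fM lee_fin.
have : 0 <= \int[mu]_x f^\+ x by exact: integral_ge0.
have : 0 <= \int[mu]_x f^\- x by exact: integral_ge0.
have : 0 <= \int[mu]_x (M%:E - f x).
  by apply: integral_ge0 => x _; exact: subM_ge0.
move: (\int[mu]_x f^\+ x) (\int[mu]_x f^\- x) (\int[mu]_x (M%:E - f x)).
move=> [p| |] [q| |] [r| |]//= _ _ _ _.
by rewrite -!EFinD => -[] *; congr EFin; lra.
Qed.

Lemma le_integral_ub mu f g M : (0 <= M)%R ->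
  measurable_fun [set: T] f -> measurable_fun [set: T] g ->
  (forall x, f x <= g x) -> (forall x, g x <= M%:E) ->
  \int[mu]_x f x <= \int[mu]_x g x.
Proof.
move=> M0 mf mg fg gM; have fM x : f x <= M%:E by rewrite (le_trans (fg x)).
rewrite (integral_subM mu f M)// (integral_subM mu g M)// leeB//.
apply: ge0_le_integral => //; [|exact: measurable_subM|exact: measurable_subM|].
- by move=> x _; exact: subM_ge0.
- by move=> x _; rewrite leeB.
Qed.

Lemma integral_le_ub mu f M : (0 <= M)%R -> measurable_fun [set: T] f ->
  (forall x, f x <= M%:E) -> \int[mu]_x f x <= M%:E.
Proof.
move=> M0 mf fM; rewrite (integral_subM mu f M)// -[leRHS]sube0 leeB//.
by apply: integral_ge0 => x _; exact: subM_ge0.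
Qed.

(** Monotone convergence for the nonnegative increasing functions [M - g n]. *)
Lemma decreasing_convergence mu (g : nat -> T -> \bar R) f M : (0 <= M)%R ->
  (forall n, measurable_fun [set: T] (g n)) ->
  (forall x n, g n x <= M%:E) ->
  (forall x, {homo g ^~ x : m n / (m <= n)%N >-> n <= m}) ->
  (forall x, g n x @[n --> \oo] --> f x) ->
  \int[mu]_x g n x @[n --> \oo] --> \int[mu]_x f x.
Proof.
move=> M0 mg gM g_dec gf.
have mf : measurable_fun [set: T] f.
  by apply: (emeasurable_fun_cvg g) => // x _; exact: gf.
have fM x : f x <= M%:E.
  by rewrite -(cvg_lim _ (gf x))//; apply: lime_le; [exact/cvgP/gf|exact: nearW].
rewrite (integral_subM mu f M)//.
under eq_cvg do rewrite (integral_subM mu (g _) M)//.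
have -> : \int[mu]_x (M%:E - f x) =
    \int[mu]_x limn (fun n => M%:E - g n x).
  apply: eq_integral => x _; apply/esym/cvg_lim => //.
  by apply: cvgeB => //; exact: cvg_cst.
apply: cvgeB => //; first exact: cvg_cst.
apply: cvg_monotone_convergence => //.
- by move=> n; exact: measurable_subM.
- by move=> n x _; exact: subM_ge0.
- by move=> x _ m n mn; rewrite leeB// g_dec.
Qed.

(** Fatou's lemma for the nonnegative functions [M - g n], whose lower limit is [M] minus the upper
    limit of [g n]. *)
Lemma reverse_fatou mu (g : nat -> T -> \bar R) M : (0 <= M)%R ->
  (forall n, measurable_fun [set: T] (g n)) ->
  (forall x n, g n x <= M%:E) ->
  limn_esup (fun n => \int[mu]_x g n x) <= \int[mu]_x limn_esup (g ^~ x).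
Proof.
move=> M0 mg gM.
have ub x : limn_esup (g ^~ x) <= M%:E.
  rewrite limn_esup_lim; apply: lime_le; first exact: is_cvg_esups.
  by apply: nearW => n; apply: ge_ereal_sup => _ [k _ <-].
have einfE (u : nat -> \bar R) :
    limn_einf (fun n => M%:E - u n) = M%:E - limn_esup u.
  by rewrite limn_einf_shift// limn_einfN.
have subMC (u v : \bar R) : u <= M%:E - v -> v <= M%:E - u.
  case: u v => [u| |] [v| |]//=; rewrite ?(leey, leNye)//.
  by rewrite -!EFinB !lee_fin; lra.
rewrite (integral_subM mu _ M)//; last exact: measurable_fun_limn_esup.
apply: subMC; under eq_integral do rewrite -einfE.
rewrite -einfE.
apply: (le_trans (fatou mu _ _ _)) => //.
- by move=> n; exact: measurable_subM.
- by move=> n x _; exact: subM_ge0.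
rewrite le_eqVlt; apply/orP; left; apply/eqP; congr limn_einf.
apply/funext => n; rewrite (integral_subM mu (g n) M)//.
by case: (\int[mu]_x _) => [r| |]//=; rewrite -!EFinB; congr EFin; lra.
Qed.

Lemma integralZ_ub mu f M (c : R) : (0 <= c)%R -> (0 <= M)%R ->
  measurable_fun [set: T] f -> (forall x, f x <= M%:E) ->
  \int[mu]_x (c%:E * f x) = c%:E * \int[mu]_x f x.
Proof.
move=> c0 M0 mf fM.
have cfE (a : \bar R) : c%:E * M%:E - c%:E * a = c%:E * (M%:E - a).
  by rewrite muleBr.
have cfM x : c%:E * f x <= (c * M)%:E by rewrite EFinM lee_wpmul2l ?lee_fin.
rewrite (integral_subM mu _ (c * M)%R) ?mulr_ge0//; last exact: measurable_funeM.
rewrite EFinM; under eq_integral do rewrite cfE.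
rewrite ge0_integralZl//; [|exact: measurable_subM|by move=> x _; exact: subM_ge0].
by rewrite cfE -integral_subM.
Qed.

(** The integral of the nonnegative function [M - f] is additive in the measure, and [mu] agrees
    with the weighted sum [nu] on measurable sets. *)
Lemma integral_convex_comb mu mu1 mu2 (t : R) f M : (0 < t < 1)%R ->
  (forall A, measurable A -> mu A = t%:E * mu1 A + (1 - t)%:E * mu2 A) ->
  (0 <= M)%R -> measurable_fun [set: T] f -> (forall x, f x <= M%:E) ->
  \int[mu]_x f x = t%:E * \int[mu1]_x f x + (1 - t)%:E * \int[mu2]_x f x.
Proof.
move=> /andP[t0 t1] muE M0 mf fM.
have t0' : (0 <= t)%R := ltW t0.
have t1' : (0 <= 1 - t)%R by rewrite subr_ge0 ltW.
have mh := measurable_subM f M mf; have h0 := subM_ge0 f M fM.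
rewrite !(integral_subM _ f M)//.
pose nu := measure_add (mscale (NngNum t0') mu1) (mscale (NngNum t1') mu2).
rewrite (eq_measure_integral nu); last first.
  by move=> A mA _; rewrite /= muE//; apply/esym/measure_addE.
rewrite ge0_integral_measure_add// !ge0_integral_mscale//=.
have : 0 <= \int[mu1]_x (M%:E - f x) by apply: integral_ge0.
have : 0 <= \int[mu2]_x (M%:E - f x) by apply: integral_ge0.
move: (\int[mu1]_x (M%:E - f x)) (\int[mu2]_x (M%:E - f x)).
move=> [r| |] [s| |]//= _ _; rewrite ?(gt0_muley, gt0_muleNy, lte_fin, subr_gt0)//.
  by rewrite -!EFinM -!EFinD; congr EFin; lra.
Qed.

End integral_bounded_above.

(** * Continuous and semicontinuous functions against Borel probabilities *)

Section borel_integrals.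
Context {R : realType} {X : pmetricType R}.
Local Notation C := (continuousType X R).
Implicit Types (mu nu : probability (borel X) R) (g h : C) (f : X -> \bar R).
Hypothesis X_compact : compact [set: X].

Lemma open_borel (U : set X) : open U -> measurable (U : set (borel X)).
Proof. by move=> oU; exact: sub_sigma_algebra. Qed.

Lemma measurable_cfun g : measurable_fun [set: borel X] (g : borel X -> R).
Proof.
apply: (measurability _ (RGenOpens.measurableE R)).
move=> _ [_ [a [b ->] <-]]; rewrite setTI; apply: open_borel.
by apply: open_comp => [x _|]; [exact: cts_fun|exact: interval_open].
Qed.

Lemma integrable_cfun mu g : mu.-integrable [set: borel X] (EFin \o g).
Proof.
apply: measurable_bounded_integrable => //.
- by rewrite (le_lt_trans (probability_le1 _ _))// ltry.
- exact: measurable_cfun.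
have [M _ gM] := cfun_bounded X_compact g.
exists M; split; first exact: num_real.
by move=> N MN x _; exact: (le_trans (gM x) (ltW MN)).
Qed.

(** Taking [fine] loses nothing: on a compact space a continuous function is bounded, hence
    integrable. *)
Definition cint mu g : R := fine (\int[mu]_x (g x)%:E).

Lemma cintE mu g : \int[mu]_x (g x)%:E = (cint mu g)%:E.
Proof.
by rewrite fineK//; exact: (integrable_fin_num measurableT (integrable_cfun mu g)).
Qed.

Lemma cint_cst mu (c : R) : cint mu (cst c) = c.
Proof.
by apply: EFin_inj; rewrite -cintE/= integral_cst//= probability_setT mule1.
Qed.

Lemma cintZD mu a g h : (cint mu (a *: g + h) = a * cint mu g + cint mu h)%R.
Proof.
apply: EFin_inj; rewrite -cintE EFinD EFinM -!cintE.
have ig := integrable_cfun mu g; have ih := integrable_cfun mu h.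
have iag := integrableZl measurableT a ig.
transitivity (\int[mu]_x (a%:E * (EFin \o g) x + (EFin \o h) x)).
  exact: eq_integral.
by rewrite (integralD measurableT iag ih) (integralZl measurableT ig).
Qed.

Lemma le_cint mu g h : (forall x, g x <= h x)%R -> (cint mu g <= cint mu h)%R.
Proof.
move=> gh; rewrite -lee_fin -!cintE.
apply: (le_integral measurableT (integrable_cfun mu g) (integrable_cfun mu h)).
by move=> x _; rewrite lee_fin.
Qed.

Section usc.
Variables (f : X -> \bar R) (M : R).
Hypotheses (f_usc : upper_semicontinuous f) (fM : forall x, f x <= M%:E).

(** The same sequence serves every [mu], so two measures can be compared through it. *)
Lemma usc_integral_approx : exists g : nat -> C,
  [/\ forall n x, f x <= (g n x)%:E &
      forall mu, (cint mu (g n))%:E @[n --> \oo] --> \int[mu]_x f x].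
Proof.
have [g [fg g_dec gf gM]] := usc_approx f M f_usc fM.
exists g; split => // mu.
under eq_cvg do rewrite -cintE.
apply: (@decreasing_convergence _ _ _ mu _ _ `|M|%R) => // [n|x n].
  by apply/measurable_EFinP; exact: measurable_cfun.
by rewrite lee_fin.
Qed.

Lemma usc_measurable : measurable_fun [set: borel X] (f : borel X -> \bar R).
Proof.
have [g [_ _ gf _]] := usc_approx f M f_usc fM.
apply: (emeasurable_fun_cvg (fun n (x : borel X) => (g n x)%:E)) => [n|x _].
  by apply/measurable_EFinP; exact: measurable_cfun.
exact: gf.
Qed.

Lemma usc_integral_le_cint mu g : (forall x, f x <= (g x)%:E) ->
  \int[mu]_x f x <= (cint mu g)%:E.
Proof.
move=> fg; have [N N0 gN] := cfun_bounded X_compact g.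
rewrite -cintE; apply: (@le_integral_ub _ _ _ mu _ _ N) => //.
- exact: usc_measurable.
- by apply/measurable_EFinP; exact: measurable_cfun.
- by move=> x; rewrite lee_fin (le_trans (ler_norm _)).
Qed.

(** Together with [usc_integral_le_cint], this makes the integral of [f] the infimum of the
    integrals of its continuous majorants. *)
Lemma usc_integral_lt mu (a : \bar R) : \int[mu]_x f x < a ->
  exists2 g : C, (forall x, f x <= (g x)%:E) & (cint mu g)%:E < a.
Proof.
move=> fa; have [g [fg /(_ mu) gmu]] := usc_integral_approx.
have [c [fc ca]] := lte_dense_fin _ _ fa.
have [n /= gnc] : exists n, (cint mu (g n))%:E < c%:E.
  apply: contrapT => /forallNP gc.
  have : c%:E <= \int[mu]_x f x.
    rewrite -(cvg_lim _ gmu)//; apply: lime_ge; first exact/cvgP/gmu.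
    by apply: nearW => n; rewrite leNgt; exact/negP/gc.
  by rewrite leNgt fc.
by exists (g n) => //; exact: lt_trans ca.
Qed.

End usc.

Lemma closed_usc (K : set X) : closed K ->
  upper_semicontinuous (fun x => (\1_K x : R)%:E).
Proof.
move=> clK x a; rewrite indicE lte_fin; case: (boolP (x \in K)) => xK a0.
  apply: nearW => y; rewrite lte_fin (le_lt_trans _ a0)// indicE.
  by case: (_ \in _).
have : nbhs x (~` K).
  apply: open_nbhs_nbhs; split; first exact: closed_openC.
  by move: xK; rewrite notin_setE.
by apply: filterS => y /= yK; rewrite lte_fin indicE memNset.
Qed.

(** The indicator of a closed set is a decreasing limit of continuous functions, so the measures
    agree on closed sets, hence on open sets, a generating family stable under intersection. *)
Lemma probability_eq_cint mu nu : (forall g, cint mu g = cint nu g) ->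
  forall A : set (borel X), measurable A -> mu A = nu A.
Proof.
move=> munu.
have closedE (K : set X) : closed K -> mu K = nu K.
  move=> clK.
  have mK : measurable (K : set (borel X)).
    rewrite -(setCK K); apply: measurableC; apply: open_borel.
    exact: closed_openC.
  have K1 x : ((\1_K x : R)%:E <= 1%:E) by rewrite lee_fin indicE; case: (_ \in _).
  have [g [_ gK]] := usc_integral_approx _ 1%R (closed_usc K clK) K1.
  rewrite -[K]setIT -!integral_indic//.
  rewrite -(cvg_lim _ (gK mu))// -(cvg_lim _ (gK nu))//.
  by congr (limn _); apply/funext => n; rewrite munu.
move=> A mA.
apply: (@measure_unique _ R (borel X) (@open X) (fun=> setT)
  _ _ _ _ mu nu _ _ A mA) => //.
- by move=> U V; exact: openI.
- by move=> _; exact: openT.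
- by rewrite bigcup_const.
- move=> U oU; rewrite -(setCK U).
  have mU : measurable (~` U : set (borel X)).
    by apply: measurableC; exact: open_borel.
  rewrite /= (probability_setC mu mU) (probability_setC nu mU); congr (1 - _).
  by apply: closedE; exact: open_closedC.
- by move=> _; rewrite (le_lt_trans (probability_le1 _ _))// ltry.
Qed.

End borel_integrals.

(** * The Riesz-Markov theorem *)

Section states.
Context {R : realType} {X : pmetricType R}.
Local Notation C := (continuousType X R).
Implicit Types (g h : C) (L : C -> R).
Local Open Scope ring_scope.

Lemma cfun_min_cts g h : continuous (fun x => Num.min (g x) (h x)).
Proof. by move=> x; apply: continuous_min; exact: cts_fun. Qed.

Definition cfun_min g h : C := mkcts (cfun_min_cts g h).

Lemma cfunE : (((forall x, (0 : C) x = 0)%R *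
  (forall (g h : C) x, (g + h) x = g x + h x)%R)
  * ((forall (g : C) x, (- g) x = - g x)%R *
  (forall a (g : C) x, (a *: g) x = a * g x)%R))%type.
Proof. by []. Qed.

Lemma cfun_sumE n (u : 'I_n -> C) x : (\sum_i u i) x = \sum_i u i x.
Proof. by elim/big_rec2 : _ => //= i y f _ <-. Qed.

Lemma cfun_open_lt g (a : R) : open [set x | g x < a].
Proof.
rewrite -[X in open X]/(g @^-1` [set y | y < a]).
by apply: open_comp => [x _|]; [exact: cts_fun|exact: open_lt].
Qed.

Lemma cfun_open_gt g (a : R) : open [set x | a < g x].
Proof.
rewrite -[X in open X]/(g @^-1` [set y | a < y]).
by apply: open_comp => [x _|]; [exact: cts_fun|exact: open_gt].
Qed.

(** The common form of integrals, of the evaluations [g |-> P^n g x] and of orbit averages.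
    Positivity and normalization bound these functionals uniformly, so that they have ultrafilter
    limits. *)
Definition is_state L : Prop :=
  [/\ forall a g h, L (a *: g + h) = a * L g + L h,
      forall g, (forall x, 0 <= g x) -> 0 <= L g &
      L (cst 1) = 1].

Section state_theory.
Variable L : C -> R.
Hypothesis L_state : is_state L.

Let L_lin a g h : L (a *: g + h) = a * L g + L h.
Proof. by case: L_state. Qed.

Lemma stateD g h : L (g + h) = L g + L h.
Proof. by rewrite -[g in LHS]scale1r L_lin mul1r. Qed.

Lemma state0 : L 0 = 0.
Proof. by apply: (addrI (L 0)); rewrite -stateD !addr0. Qed.

Lemma stateZ a g : L (a *: g) = a * L g.
Proof. by rewrite -[a *: g]addr0 L_lin state0 addr0. Qed.

Lemma stateB g h : L (g - h) = L g - L h.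
Proof. by rewrite stateD -scaleN1r stateZ mulN1r. Qed.

Lemma state_cst (c : R) : L (cst c) = c.
Proof.
have -> : (cst c : C) = c *: (cst 1 : C).
  by apply/continuousEP => x; rewrite /= -[LHS]mulr1.
by case: L_state => _ _ L1; rewrite stateZ L1 mulr1.
Qed.

Lemma state_sum n (u : 'I_n -> C) : L (\sum_i u i) = \sum_i L (u i).
Proof.
by elim/big_rec2 : _ => [|i y f _ <-]; [exact: state0|exact: stateD].
Qed.

Lemma le_state g h : (forall x, g x <= h x) -> L g <= L h.
Proof.
move=> gh; rewrite -subr_ge0 -stateB; case: L_state => _ L0 _.
by apply: L0 => x; rewrite [leRHS]/= subr_ge0.
Qed.

Lemma state_le_cst g (c : R) : (forall x, g x <= c) -> L g <= c.
Proof. by move=> gc; rewrite -[leRHS]state_cst; exact: le_state. Qed.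

End state_theory.

End states.

Lemma cint_state {R : realType} {X : pmetricType R}
  (mu : probability (borel X) R) : compact [set: X] -> is_state (cint mu).
Proof.
move=> X_compact; split; first exact: cintZD.
- move=> g g0; rewrite -[leLHS](cint_cst X_compact mu); exact: le_cint.
- exact: cint_cst.
Qed.

(** One minus the decreasing approximations of the indicator of the closed complement. *)
Lemma open_approx {R : realType} {X : pmetricType R} (U : set X) : open U ->
  exists u : nat -> continuousType X R,
  [/\ forall n x, (0 <= u n x <= \1_U x)%R,
      forall x, {homo u ^~ x : m n / (m <= n)%N >-> (m <= n)%R} &
      forall x e, U x -> (0 < e)%R -> exists n, (1 - e < u n x)%R].
Proof.
move=> oU.
have K1 x : ((\1_(~` U) x : R)%:E <= 1%:E).
  by rewrite lee_fin indicE; case: (_ \in _).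
have [g [Kg g_dec gK g1]] :=
  usc_approx _ 1%R (closed_usc (~` U) (open_closedC oU)) K1.
pose u n : continuousType X R := ((cst 1%R : continuousType X R) - g n)%R.
have uE n x : u n x = (1 - g n x)%R by [].
have KE x : (\1_(~` U) x = 1 - \1_U x :> R)%R.
  by rewrite !indicE in_setC; case: (_ \in _); rewrite /= ?subrr ?subr0.
exists u; split.
- move=> n x; rewrite uE; have := Kg n x; have := g1 n x.
  by rewrite normr1 lee_fin KE => ? ?; apply/andP; split; lra.
- by move=> x m n mn; rewrite !uE lerB// g_dec.
move=> x e Ux e0; have := gK x.
rewrite KE indicE mem_set//= subrr => /fine_cvgP[_ /cvgrPdist_lt/(_ e e0)].
case=> n _ /(_ n (leqnn n)) /=; rewrite sub0r normrN ltr_norml => /andP[_ gne].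
by exists n; rewrite uE; lra.
Qed.

Section riesz.
Context {R : realType} {X : pmetricType R}.
Local Notation C := (continuousType X R).
Hypothesis X_compact : compact [set: X].
Variable L : C -> R.
Hypothesis L_state : is_state L.

Let below (U : set X) (g : C) := forall x, (0 <= g x <= \1_U x)%R.

(** The future measure of an open set. Test functions lie below the indicator instead of having
    support in [U]; cutting them at a small level [e] makes up for this. *)
Let lam (U : set X) : \bar R := ereal_sup [set (L g)%:E | g in below U].

Let le_lam U g : below U g -> (L g)%:E <= lam U.
Proof. by move=> Ug; apply: ereal_sup_ubound; exists g. Qed.

Let lam_ge0 U : 0 <= lam U.
Proof.
have <- : (L 0%R)%:E = 0 by rewrite state0.
apply: le_lam => x; by rewrite cfunE lexx indicE ler0n.
Qed.

Let lam_le1 U : lam U <= 1.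
Proof.
apply: ge_ereal_sup => _ [g gU <-]; rewrite lee_fin.
apply: (state_le_cst _ L_state) => x; have /andP[_ /le_trans] := gU x; apply.
by rewrite indicE; case: (_ \in _).
Qed.

Let lam_mono U V : U `<=` V -> lam U <= lam V.
Proof.
move=> UV; apply: ge_ereal_sup => _ [g gU <-]; apply: le_lam => x.
have /andP[-> /le_trans ->//] := gU x.
rewrite !indicE; have [/set_mem/UV/mem_set ->//|] := boolP (x \in U).
by case: (_ \in _).
Qed.

(** With [u i n] increasing to the indicator of [U i], the functions [g - e - \sum_(i < n) u i n]
    decrease and become negative at each point. Dini's theorem gives one [n] for all points, and
    positivity of [L] bounds [L g - e] by a finite sum. *)
Let lam_sigma_subadditive (U : nat -> set X) : (forall i, open (U i)) ->
  lam (\bigcup_i U i) <= \sum_(i <oo) lam (U i).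
Proof.
move=> oU; apply: ge_ereal_sup => _ [g gU <-].
apply/lee_addgt0Pr => e e0; rewrite -leeBlDr//.
have /choice[u uP] := fun i => open_approx (U i) (oU i).
pose s n : C := (\sum_(i < n) u i n)%R.
pose v n : C := (g - (cst e : C) - s n)%R.
have vE n x : v n x = (g x - e - \sum_(i < n) u i n x)%R.
  by rewrite /v /s !cfunE cfun_sumE.
have [x m n mn|x|n vn] := dini X_compact v.
- rewrite !vE lerB// (big_ord_widen n (fun i => u i m x) mn)/=.
  rewrite big_mkcond/=; apply: ler_sum => i _.
  have [u01 u_inc _] := uP i; case: ifP => _; first exact: u_inc.
  by case/andP: (u01 n x).
- have [Ux|Ux] := pselect ((\bigcup_i U i) x); last first.
    exists 0%N; rewrite vE big_ord0 subr0.
    by have := gU x; rewrite indicE memNset//=; lra.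
  case: (Ux) => i _ Uix; have [u01 u_inc u1] := uP i.
  have [N uN] := u1 x e Uix e0.
  (* The index must exceed [i] for [u i] to occur in the sum, and reach [N] for its value at [x] to
     exceed [1 - e]. *)
  exists (maxn i.+1 N); rewrite vE.
  have iN : (i < maxn i.+1 N)%N by rewrite leq_max ltnSn.
  have : (u i (maxn i.+1 N) x <= \sum_(j < maxn i.+1 N) u j (maxn i.+1 N) x)%R.
    rewrite (bigD1 (Ordinal iN))//= lerDl; apply: sumr_ge0 => j _.
    by have [/(_ (maxn i.+1 N) x)/andP[]] := uP j.
  have := u_inc x _ _ (leq_maxr i.+1 N).
  by have := gU x; rewrite indicE mem_set//=; lra.
apply: (@le_trans _ _ (\sum_(0 <= i < n) lam (U i))); last first.
  by apply: nneseries_lim_ge => i _ _; exact: lam_ge0.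
apply: (@le_trans _ _ (\sum_(i < n) (L (u i n))%:E)); last first.
  rewrite big_mkord; apply: lee_sum => i _; apply: le_lam => x.
  by have [] := uP i.
rewrite sumEFin -state_sum// lee_fin -(state_cst _ L_state e) -stateB//.
apply: le_state => // x; have := vn x.
by rewrite vE -cfun_sumE -[leLHS]/(g x - e)%R; lra.
Qed.

Let outer (A : set X) : \bar R :=
  ereal_inf [set lam U | U in [set U | open U /\ A `<=` U]].

Let outer_le A U : open U -> A `<=` U -> outer A <= lam U.
Proof. by move=> oU AU; apply: ereal_inf_lbound; exists U. Qed.

Let outer_open U : open U -> outer U = lam U.
Proof.
move=> oU; apply/eqP; rewrite eq_le outer_le//=.
by apply: le_ereal_inf_tmp => _ [V [oV UV] <-]; exact: lam_mono.
Qed.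

Let outer0 : outer set0 = 0.
Proof.
rewrite outer_open; last exact: open0.
apply/eqP; rewrite eq_le lam_ge0 andbT; apply: ge_ereal_sup => _ [g g0 <-].
rewrite lee_fin; apply: (state_le_cst _ L_state) => x.
by have := g0 x; rewrite indic0 => /andP[].
Qed.

Let outer_ge0 A : 0 <= outer A.
Proof. by apply: le_ereal_inf_tmp => _ [U _ <-]. Qed.

Let outer_mono : {homo outer : A B / A `<=` B >-> A <= B}.
Proof.
move=> A B AB; apply: le_ereal_inf_tmp => _ [U [oU BU] <-].
by apply: outer_le => //; exact: subset_trans BU.
Qed.

Let outer_fin A : outer A \is a fin_num.
Proof.
rewrite ge0_fin_numE//; apply: (@le_lt_trans _ _ (lam setT)).
  by apply: outer_le => //; exact: openT.
by rewrite (le_lt_trans (lam_le1 _))// ltry.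
Qed.

Let outer_sigma_subadditive : sigma_subadditive outer.
Proof.
move=> F; apply/lee_addgt0Pr => e e0.
have /choice[U UP] : forall i, exists U, [/\ open U, F i `<=` U &
    lam U <= outer (F i) + (e / (2 ^ i.+1)%:R)%:E].
  move=> i; have : outer (F i) < outer (F i) + (e / (2 ^ i.+1)%:R)%:E.
    by rewrite lteDl// lte_fin divr_gt0// ltr0n expn_gt0.
  by move=> /ereal_inf_lt[_ [U [oU FU] <-]] /ltW ?; exists U.
apply: le_trans (epsilon_trick xpredT _ (ltW e0)) => //.
apply: (@le_trans _ _ (lam (\bigcup_i U i))).
  apply: outer_le; first by apply: bigcup_open => i _; have [] := UP i.
  by apply: subset_bigcup => i _; have [] := UP i.
apply: (le_trans (lam_sigma_subadditive _ _)) => [i|]; first by have [] := UP i.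
by apply: lee_nneseries => // i _; have [] := UP i.
Qed.

Let outer_isOuter := isOuterMeasure.Build R X outer outer0 outer_ge0
  outer_mono outer_sigma_subadditive.
Let outer_om : {outer_measure set X -> \bar R} := HB.pack outer outer_isOuter.

(** For [g] below the indicator of [V] meet [U], the part [W] of [V] where [g < e] is open and
    contains [V] minus [U]. The cut function [g - min g e] vanishes on [W], so adding any [h] below
    the indicator of [W] stays below that of [V], and the cut costs at most [e]. *)
Let open_caratheodory U : open U -> outer_om.-caratheodory U.
Proof.
have rearrange (p q r s : R) : (p <= s -> r + q <= q - p + r + s)%R by lra.
move=> oU; apply: le_caratheodory_measurable => A /=.
apply: le_ereal_inf_tmp => _ [V [oV AV] <-].
have oVU : open (V `&` U) by exact: openI.
apply: (@le_trans _ _ (lam (V `&` U) + outer (V `&` ~` U))).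
  apply: leeD; last by apply: outer_mono; exact: setSI.
  by apply: outer_le => //; exact: setSI.
rewrite -leeBrDr//; apply: ge_ereal_sup => _ [g gVU <-].
rewrite leeBrDr//; apply/lee_addgt0Pr => e e0.
pose W := V `&` [set x | (g x < e)%R].
have oW : open W.
  by apply: openI => //; exact: cfun_open_lt.
have gE x : ~ (V `&` U) x -> (g x <= 0)%R.
  by move=> VUx; have := gVU x; rewrite indicE memNset// => /andP[].
have : outer (V `&` ~` U) <= lam W.
  apply: outer_le => // x [Vx Ux]; split => //=.
  by rewrite (le_lt_trans _ e0)// gE// => -[].
move=> /(leeD2l (L g)%:E)/le_trans; apply.
rewrite addeC -leeBrDr//; apply: ge_ereal_sup => _ [h hW <-].
rewrite leeBrDr//.
pose k : C := (g - cfun_min g (cst e) + h)%R.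
have kE x : k x = (g x - Num.min (g x) e + h x)%R by [].
have : (L k)%:E <= lam V.
  apply: le_lam => x; rewrite kE; have := gVU x; have := hW x; rewrite !indicE.
  have [xV|xV] := boolP (x \in V); last first.
    rewrite !memNset;
      last by move=> []; rewrite -in_setE => /idP; rewrite (negbTE xV).
      by rewrite /= minEle; case: ifP; lra.
    by move=> []; rewrite -in_setE => /idP; rewrite (negbTE xV).
  have [ge|eg] := ltP (g x) e.
    rewrite (mem_set (A := W)); last by split => //; exact: set_mem.
    by case: (_ \in _) => /=; lra.
  rewrite (memNset (A := W)); last by move=> [_ /=]; rewrite ltNge eg.
  by case: (_ \in _) => /=; lra.
move=> /(leeD2r e%:E); apply: le_trans.
rewrite -!EFinD lee_fin stateD// stateB//.
have : (L (cfun_min g (cst e)) <= e)%R.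
  apply: state_le_cst => // x.
  by rewrite -[leLHS]/(Num.min (g x) e) ge_min lexx orbT.
exact: rearrange.
Qed.

Let borel_caratheodory (A : set (borel X)) : measurable A ->
  outer_om.-cara.-measurable A.
Proof.
move: A; apply: smallest_sub; last exact: open_caratheodory.
exact: (@sigma_algebra_measurable _ (caratheodory_type outer_om)).
Qed.

Let outer_sigma_additive : semi_sigma_additive (outer : set (borel X) -> \bar R).
Proof.
move=> F mF tF mUF.
apply: (caratheodory_measure_sigma_additive (mu := outer_om)) => //.
- by move=> i; exact: borel_caratheodory.
- exact: borel_caratheodory.
Qed.

Let outerT : outer setT = 1.
Proof.
rewrite outer_open; last exact: openT.
apply/eqP; rewrite eq_le lam_le1/=; case: L_state => _ _ L1.
rewrite -L1; apply: le_lam => x.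
by rewrite indicE in_setT /= ler01 lexx.
Qed.

Let nu : set (borel X) -> \bar R := outer.
Let nu_isMeasure := isMeasure.Build _ (borel X) R nu outer0 outer_ge0
  outer_sigma_additive.
Let nu_measure : {measure set (borel X) -> \bar R} := HB.pack nu nu_isMeasure.
Let nu_isProba := Measure_isProbability.Build _ (borel X) R nu_measure outerT.
Let P : probability (borel X) R := HB.pack nu nu_isMeasure nu_isProba.

(* Compare both sides on the slices [min g (i + 1) - min g i] of [g]: such a
   slice lies below the indicator of [g > i], which lies below the previous
   slice. *)
Let state_le_cint1 (g : C) : (forall x, (0 <= g x)%R) -> (L g <= cint P g + 1)%R.
Proof.
move=> g0; pose h i := cfun_min g (cst i%:R).
have hE i x : h i x = Num.min (g x) i%:R by [].
have cP := cint_state P X_compact.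
have hS i x : (h i.+1 x - h i x =
    if g x <= i%:R then 0 else if g x <= i%:R + 1 then g x - i%:R else 1)%R.
  rewrite !hE -natr1; have [gi|gi] := leP (g x) i%:R.
    by rewrite min_l ?subrr// (le_trans gi)// lerDl.
  by have [gi1|gi1] := leP (g x) (i%:R + 1)%R; rewrite // addrC addKr.
have slice i : (L (h i.+2) - L (h i.+1) <= cint P (h i.+1) - cint P (h i))%R.
  pose U := [set x | (i.+1%:R < g x)%R].
  have oU : open U by exact: cfun_open_gt.
  rewrite -!stateB// -lee_fin; apply: (@le_trans _ _ (lam U)).
    apply: le_lam => x; rewrite !cfunE hS indicE.
    have [gx|gx] := leP (g x) i.+1%:R; first by rewrite lexx ler0n.
    rewrite mem_set//=.
    have [gx1|gx1] := leP (g x) (i.+1%:R + 1)%R; rewrite ?ler01 ?lexx//.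
    by apply/andP; split; lra.
  rewrite -outer_open// -[outer U]/(P U) -[U]setIT -integral_indic//;
    last exact: open_borel.
  have hi x : (0 <= (h i.+1 - h i)%R x)%R.
    rewrite !cfunE hS; have [gi|gi] := leP (g x) i%:R => //.
    by case: ifP => // _; rewrite subr_ge0 ltW.
  rewrite -cintE//; apply: ge0_le_integral; first exact: measurableT.
  - by move=> x _; rewrite lee_fin indicE ler0n.
  - by apply/measurable_EFinP/measurable_indic; exact: open_borel.
  - by apply/measurable_EFinP; exact: measurable_cfun.
  move=> x _; rewrite lee_fin indicE.
  have [/set_mem /= gx|_] := boolP (x \in U); last exact: hi.
  have gi : (g x <= i%:R)%R = false by rewrite leNgt (lt_trans _ gx) ?ltr_nat.
  have gi1 : (g x <= i%:R + 1)%R = false by rewrite natr1 leNgt gx.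
  by rewrite !cfunE hS gi gi1.
(* The slice bounds telescope; the loss of [1] is the lowest slice, which has none beneath it. *)
have Lh i : (L (h i.+1) <= cint P (h i) + 1)%R.
  elim: i => [|i IH]; last by move: (slice i) IH; lra.
  apply: (@le_trans _ _ 1%R).
    by apply: state_le_cst => // x; rewrite hE ge_min lexx orbT.
  rewrite lerDr; case: cP => _ c0 _; apply: c0 => x.
  by rewrite hE le_min g0/=.
have [M M0 gM] := cfun_bounded X_compact g.
have hg i : (M <= i%:R)%R -> h i = g.
  move=> Mi; apply/continuousEP => x; rewrite hE min_l//.
  by rewrite (le_trans _ Mi)// (le_trans (ler_norm _)).
have MN := ltW (truncnS_gt M).
rewrite -[X in (L X <= _)%R](hg (Num.truncn M).+2); last first.
  by rewrite (le_trans MN)// ler_nat.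
by rewrite -[X in (_ <= cint _ X + _)%R](hg (Num.truncn M).+1).
Qed.

(** The measure is the restriction of [outer] to Borel sets, named [P] here. Applying the comparison
    to [g / e] shrinks its error [1] to [e]; adding a constant lifts the sign condition, and passing
    to [- g] turns the inequality into an equality. *)
Lemma riesz_markov : exists mu : probability (borel X) R,
  forall g, cint mu g = L g.
Proof.
have cP := cint_state P X_compact.
have le1 (g : C) : (forall x, (0 <= g x)%R) -> (L g <= cint P g)%R.
  move=> g0; apply/ler_addgt0Pr => e e0.
  have ge0 x : (0 <= (e^-1 *: g) x)%R.
    by rewrite -[leRHS]/(e^-1 * g x)%R mulr_ge0// invr_ge0 ltW.
  have := state_le_cint1 _ ge0; rewrite !stateZ//.
  by rewrite -(ler_pM2l e0) mulrDr !mulrA mulfV ?gt_eqF// !mul1r mulr1.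
have le2 (g : C) : (L g <= cint P g)%R.
  have [M M0 gM] := cfun_bounded X_compact g.
  rewrite -(lerD2r M) -[X in (_ + X <= _)%R](state_cst _ L_state).
  rewrite -[X in (_ <= _ + X)%R](state_cst _ cP) -!stateD//; apply: le1 => x.
  by rewrite -[leRHS]/(g x + M)%R; have := gM x; rewrite ler_norml; lra.
exists P => g; apply/eqP; rewrite eq_le le2 andbT.
have := le2 (- g)%R; rewrite -[(- g)%R]sub0r !stateB// !state0//; lra.
Qed.

End riesz.

(** * Invariant measures and the Bauer maximum principle *)

(** A cluster point in the compact segment is a limit: an ultrafilter contains the preimage of each
    neighbourhood or its complement. *)
Lemma ultra_bounded_cvg {R : realType} (T : Type) (U : set_system T)
    (f : T -> R) (M : R) : UltraFilter U ->
  (\forall t \near U, (`|f t| <= M)%R) -> exists l : R, f t @[t --> U] --> l.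
Proof.
move=> UU fM.
have : (f t @[t --> U]) `[(- M)%R, M]%classic.
  by apply: filterS fM => t; rewrite /= in_itv/= ler_norml.
move=> /(segment_compact _) [l [_ fl]]; exists l => V lV.
have [//|UnV] := in_ultra_setVsetC (f @^-1` V) UU.
have [x [nVx Vx]] : (~` V) `&` V !=set0 by apply: fl.
by case: nVx.
Qed.

Section ultralimits.
Context {R : realType} {X : pmetricType R}.
Local Notation C := (continuousType X R).
Hypothesis X_compact : compact [set: X].

Lemma state_norm_le (L : C -> R) (g : C) (M : R) : is_state L ->
  (forall x, `|g x| <= M)%R -> (`|L g| <= M)%R.
Proof.
move=> L_state gM; rewrite ler_norml; apply/andP; split.
  rewrite -[leLHS](state_cst _ L_state); apply: le_state => // x /=.
  by have := gM x; rewrite ler_norml => /andP[].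
by apply: state_le_cst => // x; rewrite (le_trans (ler_norm _)).
Qed.

(** Weak compactness: the limit is taken for each [g] separately, remains a state, and is
    represented by Riesz-Markov. *)
Lemma state_ultralimit (T : Type) (U : set_system T) (L : T -> C -> R) :
  UltraFilter U -> (\forall t \near U, is_state (L t)) ->
  exists mu : probability (borel X) R,
    forall g, L t g @[t --> U] --> cint mu g.
Proof.
move=> UU L_state.
have /choice[l Ll] : forall g : C, exists l : R, L t g @[t --> U] --> l.
  move=> g; have [M _ gM] := cfun_bounded X_compact g.
  apply: (ultra_bounded_cvg _ _ _ M) => //.
  by apply: filterS L_state => t ?; exact: state_norm_le.
suff /(riesz_markov X_compact)[mu mul] : is_state l.
  by exists mu => g; rewrite mul.
split.
- move=> a g h.
  have agh : (a * L t g + L t h)%R @[t --> U] --> (a * l g + l h)%R.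
    by apply: cvgD => //; apply: cvgMl_tmp.
  have lin : (a * L t g + L t h)%R @[t --> U] --> l (a *: g + h)%R.
    apply: cvg_trans (Ll (a *: g + h)%R); apply: near_eq_cvg.
    by apply: filterS L_state => t Lt; rewrite stateD// stateZ.
  exact: cvg_unique lin agh.
- move=> g g0; apply: (cvgr_to_ge (Ll g)).
  by apply: filterS L_state => t [_ L0 _]; exact: L0.
- apply: (cvg_unique _ (Ll (cst 1%R))) => //.
  apply: cvg_near_cst; apply: filterS L_state => t Lt.
  exact: state_cst.
Qed.

End ultralimits.

Section invariant_measures.
Context {R : realType} {X : pmetricType R}.
Local Notation C := (continuousType X R).
Local Notation proba := (probability (borel X) R).
Hypothesis X_compact : compact [set: X].
Variable P : {linear C -> C}.
Let I := invariant_proba P.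
Implicit Types (mu nu : proba) (S A : set proba) (F : proba -> \bar R).

Lemma invariant_probaP mu : I mu <-> forall g, cint mu (P g) = cint mu g.
Proof.
split=> mu_inv g; last by rewrite !(cintE X_compact) mu_inv.
by apply: EFin_inj; rewrite -!(cintE X_compact).
Qed.

(** Weak convergence tested on one continuous function at a time, without a topology on the set of
    probabilities. *)
Definition weak_lim (U : set_system proba) mu :=
  forall g : C, cint nu g @[nu --> U] --> cint mu g.

(** Invariance is only asked in the limit, which covers orbit averages as well as families of
    invariant measures. *)
Lemma invariant_ultralimit (T : Type) (U : set_system T) (L : T -> C -> R) :
  UltraFilter U -> (\forall t \near U, is_state (L t)) ->
  (forall g, (L t (P g) - L t g)%R @[t --> U] --> (0 : R)%R) ->
  exists2 mu, I mu & forall g, L t g @[t --> U] --> cint mu g.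
Proof.
move=> UU L_state L_inv.
have [mu Lmu] := state_ultralimit X_compact _ _ _ UU L_state.
exists mu => //; apply/invariant_probaP => g; apply/eqP; rewrite -subr_eq0.
have LP : (L t (P g) - L t g)%R @[t --> U] --> (cint mu (P g) - cint mu g)%R.
  by apply: cvgB; exact: Lmu.
by apply/eqP; exact: cvg_unique LP (L_inv g).
Qed.

Lemma invariant_weak_lim (U : set_system proba) : UltraFilter U -> U I ->
  exists2 mu, I mu & weak_lim U mu.
Proof.
move=> UU UI; apply: (invariant_ultralimit _ _ cint) => //.
  by apply: filterS UI => nu _; exact: cint_state.
move=> g; apply: cvg_near_cst; apply: filterS UI => nu /invariant_probaP ->.
by rewrite subrr.
Qed.

Definition convex_comb mu mu1 mu2 (t : R) := forall A : set (borel X),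
  measurable A -> mu A = t%:E * mu1 A + (1 - t)%:E * mu2 A.

(** Excluding [+oo] keeps the affine identity clear of [oo - oo], while [-oo] stays possible.
    Semicontinuity is stated along ultrafilters to match [weak_lim]. *)
Record usc_affine F : Prop := UscAffine {
  usc_affine_lty : forall mu, I mu -> F mu < +oo;
  usc_affine_usc : forall U mu, UltraFilter U -> U I -> I mu -> weak_lim U mu ->
    forall a, F mu < a -> U [set nu | F nu < a];
  usc_affineE : forall mu mu1 mu2 t, I mu -> I mu1 -> I mu2 -> (0 < t < 1)%R ->
    convex_comb mu mu1 mu2 t -> F mu = t%:E * F mu1 + (1 - t)%:E * F mu2 }.

(** A continuous majorant of [f] whose integral is below [a] at [mu] keeps it below [a] along every
    ultrafilter with weak limit [mu]. *)
Lemma usc_integral_affine (f : X -> \bar R) (M : R) :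
  upper_semicontinuous f -> (forall x, f x <= M%:E) ->
  usc_affine (fun mu => \int[mu]_x f x).
Proof.
move=> f_usc fM.
have mf := usc_measurable f M f_usc fM.
have fM' x : f x <= `|M|%:E by rewrite (le_trans (fM x))// lee_fin ler_norm.
split=> [mu _|U mu UU UI Imu Umu a fa|mu mu1 mu2 t _ _ _ t01 mut].
- rewrite (@le_lt_trans _ _ `|M|%:E) ?ltry//.
  exact: (integral_le_ub _ _ mu f `|M|%R (normr_ge0 M) mf fM').
- have [g fg ga] := usc_integral_lt X_compact f M f_usc fM mu a fa.
  have [c [gc ca]] := lte_dense_fin _ _ ga; rewrite lte_fin in gc.
  have gU : \forall nu \near U, (cint nu g < c)%R.
    by apply: cvgr_lt gc; exact: Umu.
  apply: filterS gU => nu gnu /=.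
  rewrite (le_lt_trans (usc_integral_le_cint X_compact f M f_usc fM nu g fg))//.
  by rewrite (lt_trans _ ca)// lte_fin.
- exact: (integral_convex_comb _ _ mu mu1 mu2 t f `|M|%R).
Qed.

Lemma cint_affine (g : C) : usc_affine (fun mu => (cint mu g)%:E).
Proof.
have [M _ gM] := cfun_bounded X_compact g.
have -> : (fun mu => (cint mu g)%:E) = (fun mu => \int[mu]_x (g x)%:E).
  by apply/funext => mu; rewrite cintE.
apply: (usc_integral_affine _ M) => [x a|x].
  rewrite lte_fin => gxa; have gx : g y @[y --> x] --> g x by exact: cts_fun.
  by near=> y; rewrite lte_fin; near: y; exact: cvgr_lt gxa.
by rewrite lee_fin (le_trans (ler_norm _)).
Unshelve. all: by end_near. Qed.

(** Closed extreme subsets of the invariant measures. The empty set qualifies, so nonemptiness is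
    stated separately. *)
Record closed_face S : Prop := ClosedFace {
  face_sub : S `<=` I;
  face_closed : forall U mu, UltraFilter U -> U S -> I mu -> weak_lim U mu -> S mu;
  face_extreme : forall mu mu1 mu2 t, S mu -> I mu1 -> I mu2 -> (0 < t < 1)%R ->
    convex_comb mu mu1 mu2 t -> S mu1 /\ S mu2 }.

Lemma invariant_face : closed_face I.
Proof. by split. Qed.

Definition argmax S F := [set mu | S mu /\ forall nu, S nu -> F nu <= F mu].

(** The maximizing ultrafilter has a weak limit in [S], whose value cannot fall below the supremum
    by semicontinuity. *)
Lemma argmax_neq0 S F : closed_face S -> S !=set0 -> usc_affine F ->
  argmax S F !=set0.
Proof.
move=> Sface S0 Faff; have [U [UU US UF]] := ereal_sup_ultra _ S F S0.
have UI : U I by apply: filterS US; exact: face_sub.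
have [mu Imu Umu] := invariant_weak_lim U UU UI.
have Smu : S mu := face_closed _ Sface _ _ UU US Imu Umu.
exists mu; split => // nu Snu; apply: (@le_trans _ _ (ereal_sup (F @` S))).
  by apply: ereal_sup_ubound; exists nu.
rewrite leNgt; apply/negP => /lte_dense_fin[a [Fa aF]].
have Ua := usc_affine_usc _ Faff _ _ UU UI Imu Umu _ Fa.
have [pi [/= Fpi]] := filter_ex (filterI Ua (UF _ aF)).
by rewrite ltNge (ltW Fpi).
Qed.

(** A weighted mean of two numbers not above the maximum reaches it only if both do; a maximum equal
    to [-oo] is trivial. *)
Lemma argmax_face S F : closed_face S -> usc_affine F -> closed_face (argmax S F).
Proof.
move=> Sface Faff; split.
- by move=> mu [/(face_sub _ Sface)].
- move=> U mu UU UA Imu Umu.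
  have US : U S by apply: filterS UA => nu [].
  have UI : U I by apply: filterS US; exact: face_sub.
  split; first exact: face_closed Umu.
  move=> nu Snu; rewrite leNgt; apply/negP.
  move=> /(usc_affine_usc _ Faff _ _ UU UI Imu Umu) Ua.
  have [pi [/= Fpi [_ /(_ _ Snu)]]] := filter_ex (filterI Ua UA).
  by rewrite leNgt Fpi.
move=> mu mu1 mu2 t [Smu maxmu] I1 I2 t01 mut.
have [S1 S2] := face_extreme _ Sface _ _ _ _ Smu I1 I2 t01 mut.
have FE := usc_affineE _ Faff _ _ _ _ (face_sub _ Sface _ Smu) I1 I2 t01 mut.
suff [F1 F2] : F mu <= F mu1 /\ F mu <= F mu2.
  split; split => // nu Snu.
    by rewrite (le_trans (maxmu _ Snu)).
  by rewrite (le_trans (maxmu _ Snu)).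
have := maxmu _ S1; have := maxmu _ S2.
have := usc_affine_lty _ Faff _ I1; have := usc_affine_lty _ Faff _ I2.
have := usc_affine_lty _ Faff _ (face_sub _ Sface _ Smu).
move: FE; case: (F mu) => [r| |]//; last by move=> *; rewrite !leNye.
have /andP[t0 t1] := t01; have t1' : (0 < 1 - t)%R by rewrite subr_gt0.
case: (F mu1) => [p| |]//; case: (F mu2) => [q| |]//;
  rewrite ?gt0_muleNy ?lte_fin// -!EFinM -!EFinD => -[rE] _ _ _.
rewrite !lee_fin => qr pr.
have h1 := ler_wpM2l (ltW t0) pr; have h2 := ler_wpM2l (ltW t1') qr.
split; rewrite leNgt; apply/negP => lt_r.
  have : (t * p < t * r)%R by rewrite ltr_pM2l.
  lra.
have : ((1 - t) * q < (1 - t) * r)%R by rewrite ltr_pM2l.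
lra.
Qed.

(** A chain of nonempty closed faces generates a proper filter; a weak limit along a finer
    ultrafilter lies in all of them, so the intersection is nonempty and Zorn's lemma applies. *)
Lemma minimal_face S : closed_face S -> S !=set0 ->
  exists S', [/\ S' `<=` S, closed_face S', S' !=set0 &
    forall A, A `<=` S' -> closed_face A -> A !=set0 -> S' `<=` A].
Proof.
move=> Sface S0.
(* [Zorn_bigcup] yields maximal sets, so it is applied to the complements. *)
pose good A := closed_face (S `\` A) /\ S `\` A !=set0.
have [] := @Zorn_bigcup proba good.
  move=> FF goodF totF.
  (* Adding [set0], whose complement in [S] is [S], keeps the filter base nonempty for an empty
     chain. *)
  pose D := [set A | FF A \/ A = set0].
  have goodD A : D A -> good A.
    by move=> [/goodF//|->]; rewrite /good setD0.
  have totD A B : D A -> D B -> A `<=` B \/ B `<=` A.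
    by move=> [FA|->] [FB|->]; [exact: totF|right|left|left].
  have capE mu : (S `\` \bigcup_(A in FF) A) mu <-> forall A, D A -> (S `\` A) mu.
    split=> [[Smu nA] A [FA|->]|muA]; [|by split|].
      by split => // Amu; apply: nA; exists A.
    have D0 : D set0 by right.
    have [Smu _] := muA _ D0; split => // -[A FA Amu].
    by have [|_] := muA A; [left|].
  have D0 : D set0 by right.
  have FB : Filter (filter_from D (fun A => S `\` A)).
    apply: filter_from_filter; first by exists set0.
    move=> A B DA DB; have [AB|BA] := totD _ _ DA DB.
      by exists B => // mu [Smu nB]; split; split => // /AB.
    by exists A => // mu [Smu nA]; split; split => // /BA.
  have PFB : ProperFilter (filter_from D (fun A => S `\` A)).
    by apply: filter_from_proper => A /goodD[].
  split; last first.
    have [U [UU BU]] := ultraFilterLemma PFB.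
    have UD A : D A -> U (S `\` A) by move=> DA; apply: BU; exists A.
    have UI : U I.
      by apply: filterS (UD _ D0) => mu [/(face_sub _ Sface)].
    have [mu Imu Umu] := invariant_weak_lim U UU UI.
    exists mu; apply/capE => A DA.
    have [Aface _] := goodD A DA.
    by apply: (face_closed _ Aface U) => //; exact: UD.
  split.
  - by move=> mu [/(face_sub _ Sface)].
  - move=> U mu UU Ucap Imu Umu; apply/capE => A DA.
    have [Aface _] := goodD A DA; apply: (face_closed _ Aface U) => //.
    by apply: filterS Ucap => nu /capE; exact.
  - move=> mu mu1 mu2 t /capE muA I1 I2 t01 mut.
    split; apply/capE => A DA; have [Aface _] := goodD A DA;
      by have [] := face_extreme _ Aface _ _ _ _ (muA A DA) I1 I2 t01 mut.
move=> A [[Aface A0] Amax]; exists (S `\` A); split => //.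
move=> B BA Bface B0.
have BE : S `\` ~` B = B.
  by rewrite setDE setCK; apply/setIidPr => mu /BA[].
have : good (~` B) by rewrite /good BE.
apply: contraPP => SAB /(Amax _); apply; split.
  by move=> mu Amu /BA[].
by move=> BCA; apply: SAB => mu [Smu nA]; apply: contrapT => /BCA.
Qed.

(** Extremality comes from minimality: a decomposition of [mu] stays in a minimal face of the set of
    maximizers, where all measures agree on Borel sets. *)
Lemma bauer F : I !=set0 -> usc_affine F ->
  exists2 mu, ergodic_proba P mu & forall nu, I nu -> F nu <= F mu.
Proof.
move=> I0 Faff.
have Mface := argmax_face _ _ invariant_face Faff.
have M0 := argmax_neq0 _ _ invariant_face I0 Faff.
have [S [SM Sface [mu Smu] Smin]] := minimal_face _ Mface M0.
have [_ Fmu] := SM _ Smu; exists mu => //.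
(* Every continuous function is its own maximum on a minimal face, so that face
   is a single measure. *)
have Sconst nu : S nu -> forall g, cint mu g = cint nu g.
  move=> Snu g; have Sg : S `<=` argmax S (fun mu => (cint mu g)%:E).
    apply: Smin; [by move=> ? []|exact: argmax_face (cint_affine g)|].
    by apply: argmax_neq0 (cint_affine g) => //; exists mu.
  have [_ /(_ _ Snu)] := Sg _ Smu; have [_ /(_ _ Smu)] := Sg _ Snu.
  by rewrite !lee_fin => ? ?; apply/eqP; rewrite eq_le; apply/andP.
split; first exact: (face_sub _ Sface).
move=> mu1 mu2 t I1 I2 t01 mut A mA.
have [S1 S2] := face_extreme _ Sface _ _ _ _ Smu I1 I2 t01 mut.
by split; apply: probability_eq_cint => // g; apply/esym/Sconst.
Qed.

End invariant_measures.

(** * Subadditive sequences over a Markov operator *)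

Section markov_operators.
Context {R : realType} {X : pmetricType R}.
Local Notation C := (continuousType X R).
Local Notation proba := (probability (borel X) R).
Hypothesis X_compact : compact [set: X].
Variable P : {linear C -> C}.
Hypothesis P_markov : is_markov P.
Let I := invariant_proba P.

(** This functional is integration against the image of the Dirac mass at [x] under [n] steps of the
    dual operator. *)
Lemma iter_markov_state n x : is_state (fun g => iter n P g x).
Proof.
have [P_ge0 P1] := P_markov; split.
- move=> a g h.
  have -> : iter n P (a *: g + h)%R = (a *: iter n P g + iter n P h)%R.
    by elim: n => //= n ->; rewrite linearP.
  by rewrite !cfunE.
- by elim: n x => [|n IH] x g g0 //=; apply: P_ge0 => y; exact: IH.
- have -> : iter n P (cst 1%R) = cst 1%R by elim: n => //= n ->.
  by [].
Qed.

Lemma cint_iter_markov (mu : proba) n g : I mu -> cint mu (iter n P g) = cint mu g.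
Proof.
by move=> /(invariant_probaP X_compact) mu_inv; elim: n => //= n IH; rewrite mu_inv.
Qed.

(** The only access to the extended operator: iterates of [markov_ext] are compared with those of
    [P] on a continuous majorant. *)
Lemma iter_markov_ext_le n (f : X -> \bar R) (g : C) :
  (forall x, f x <= (g x)%:E) ->
  forall x, iter n (markov_ext P) f x <= (iter n P g x)%:E.
Proof.
move=> fg; elim: n => [|n IH] x //=.
by apply: ereal_inf_lbound; exists (iter n P g).
Qed.

Section subadditive.
Variable phi : nat -> X -> \bar R.
Hypothesis phi_usc : forall n, (0 < n)%N -> upper_semicontinuous (phi n).
Hypothesis phi_lty : forall n, (0 < n)%N -> forall x, phi n x < +oo.
Hypothesis phi_sub : subadditive_seq P phi.

Lemma subadditive_cfun n m (g : C) x : (0 < n)%N -> (0 < m)%N ->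
  (forall y, phi m y <= (g y)%:E) ->
  phi (n + m)%N x <= phi n x + (iter n P g x)%:E.
Proof.
move=> n0 m0 phig; rewrite (le_trans (phi_sub _ _ n0 m0 x))// leeD2l//.
exact: iter_markov_ext_le.
Qed.

Lemma subadditive_bound n m (c : R) x : (0 < n)%N -> (0 < m)%N ->
  (forall y, phi m y <= c%:E) -> phi (n + m)%N x <= phi n x + c%:E.
Proof.
move=> n0 m0 phic; rewrite (le_trans (subadditive_cfun _ _ (cst c) x n0 m0 _))//.
by rewrite (state_cst _ (iter_markov_state n x)).
Qed.

Lemma phi_max n : (0 < n)%N -> exists y, forall x, phi n x <= phi n y.
Proof.
move=> n0; have [y _ yE] := usc_has_max _ X_compact (phi_usc n n0).
by exists y => x; rewrite yE; apply: ereal_sup_ubound; exists x.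
Qed.

(** Subadditivity is applied one step at a time to an upper bound of [phi 1]; the absolute value
    makes [B] nonnegative and also covers a maximum [-oo]. *)
Lemma phi_linear_bound : exists2 B : R, (0 <= B)%R &
  forall n, (0 < n)%N -> forall x, phi n x <= (n%:R * B)%:E.
Proof.
have [y phiy] := phi_max 1%N isT.
pose B := (`|fine (phi 1%N y)|)%R.
have phiB x : phi 1%N x <= B%:E.
  rewrite (le_trans (phiy x))// /B.
  case: (phi 1%N y) (phi_lty 1%N isT y) => [r _|//|_]/=; last by rewrite leNye.
  by rewrite lee_fin ler_norm.
exists B; first exact: normr_ge0.
elim=> [//|[|n] IH _ x]; first by rewrite mul1r.
rewrite -addn1 (le_trans (subadditive_bound n.+1 1%N B x _ _ _))//.
by rewrite natrD mulrDl mul1r EFinD leeD2r// IH.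
Qed.

Lemma avg_bound : exists2 B : R, (0 <= B)%R & forall x n, avg phi n x <= B%:E.
Proof.
have [B B0 phiB] := phi_linear_bound; exists B => // x [|n].
  (* At index [0] the average is [0] whatever [phi 0] is, since [0^-1 = 0]. *)
  by rewrite /avg invr0 mul0e lee_fin.
by rewrite /avg lee_pdivrMl ?ltr0n// -EFinM phiB.
Qed.

Lemma phi_ub n : (0 < n)%N -> exists M : R, forall x, phi n x <= M%:E.
Proof.
by move=> n0; have [B _ phiB] := phi_linear_bound; exists (n%:R * B)%R; exact: phiB.
Qed.

(** For continuous majorants [g], [h] with nearly the same integrals, [g + P^n h] dominates
    [phi (n + m)], and invariance removes [P^n] under the integral. *)
Lemma int_phi_sub mu n m : I mu -> (0 < n)%N -> (0 < m)%N ->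
  \int[mu]_x phi (n + m)%N x <= \int[mu]_x phi n x + \int[mu]_x phi m x.
Proof.
move=> Imu n0 m0.
have [Mn phin] := phi_ub n n0; have [Mm phim] := phi_ub m m0.
have nm0 : (0 < n + m)%N by rewrite addn_gt0 n0.
have [Mnm phinm] := phi_ub (n + m)%N nm0.
apply: lee_addP => [||a b na mb].
- exact: (usc_affine_lty _ _
    (usc_integral_affine X_compact P _ _ (phi_usc n n0) phin)).
- exact: (usc_affine_lty _ _
    (usc_integral_affine X_compact P _ _ (phi_usc m m0) phim)).
have [g phig ga] := usc_integral_lt X_compact _ _ (phi_usc n n0) phin mu _ na.
have [h phih hb] := usc_integral_lt X_compact _ _ (phi_usc m m0) phim mu _ mb.
rewrite lte_fin in ga hb.
apply: (@le_trans _ _ (cint mu (g + iter n P h)%R)%:E).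
  apply: (usc_integral_le_cint X_compact _ _ (phi_usc _ nm0) phinm) => x.
  rewrite (le_trans (subadditive_cfun _ _ h x n0 m0 phih))// cfunE EFinD.
  by rewrite leeD2r.
rewrite lee_fin (stateD _ (cint_state mu X_compact)) cint_iter_markov//.
by rewrite lerD// ltW.
Qed.

Lemma int_avg_affine n : (0 < n)%N -> usc_affine P (fun mu => int_avg phi mu n).
Proof.
move=> n0; have [M phiM] := phi_ub n n0.
have n0' : (0 < n%:R^-1 :> R)%R by rewrite invr_gt0 ltr0n.
have [lty usc aff] := usc_integral_affine X_compact P _ _ (phi_usc n n0) phiM.
split.
- move=> mu Imu; rewrite /int_avg; have := lty mu Imu.
  case: (\int[mu]_x _) => [r| |]// _; first by rewrite -EFinM ltry.
  by rewrite gt0_muleNy ?lte_fin.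
- move=> U mu UU UI Imu Umu a; rewrite /int_avg.
  rewrite lte_pdivrMl ?ltr0n// => Fa.
  apply: filterS (usc U mu UU UI Imu Umu _ Fa) => nu /=.
  by rewrite lte_pdivrMl ?ltr0n.
move=> mu mu1 mu2 t Imu I1 I2 t01 mut.
rewrite /int_avg (aff _ _ _ _ Imu I1 I2 t01 mut).
have := lty _ I1; have := lty _ I2.
have /andP[t0 t1] := t01; have t1' : (0 < 1 - t)%R by rewrite subr_gt0.
case: (\int[mu1]_x _) => [p| |]//; case: (\int[mu2]_x _) => [q| |]// _ _;
  rewrite ?(gt0_muleNy, lte_fin, addeNy, addNye)//.
rewrite muleDr// !muleA -!EFinM -!EFinD; congr EFin; ring.
Qed.

Lemma int_avg_cvg mu : I mu ->
  int_avg phi mu n @[n --> \oo] --> inf_pos (int_avg phi mu).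
Proof.
move=> Imu; apply: fekete => [n n0|n m n0 m0]; last exact: int_phi_sub.
have [M phiM] := phi_ub n n0.
exact: (usc_affine_lty _ _
  (usc_integral_affine X_compact P _ _ (phi_usc n n0) phiM)).
Qed.

Lemma lyapunovE mu : I mu -> lyapunov phi mu = inf_pos (int_avg phi mu).
Proof. by move=> /int_avg_cvg/cvg_lim; exact. Qed.

Lemma lyapunov_le mu n : I mu -> (0 < n)%N -> lyapunov phi mu <= int_avg phi mu n.
Proof. by move=> /lyapunovE -> n0; apply: ereal_inf_lbound; exists n. Qed.

(** Semicontinuity uses the description as an infimum, affinity the description as a limit. *)
Lemma lyapunov_affine : usc_affine P (lyapunov phi).
Proof.
have lty mu : I mu -> lyapunov phi mu < +oo.
  move=> Imu; rewrite (le_lt_trans (lyapunov_le mu 1%N Imu isT))//.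
  exact: (usc_affine_lty _ _ (int_avg_affine 1%N isT)).
split => //.
- move=> U mu UU UI Imu Umu a; rewrite lyapunovE// => /ereal_inf_lt[_ [n /= n0 <-]] na.
  have := usc_affine_usc _ _ (int_avg_affine n n0) _ _ UU UI Imu Umu _ na.
  move=> Una; apply: filterS (filterI UI Una) => nu [Inu /= nua].
  by rewrite (le_lt_trans _ nua)//; exact: lyapunov_le.
move=> mu mu1 mu2 t Imu I1 I2 t01 mut.
have /andP[t0 t1] := t01; have t1' : (0 < 1 - t)%R by rewrite subr_gt0.
have c_lty (c : R) (a : \bar R) : (0 < c)%R -> a < +oo -> c%:E * a < +oo.
  by case: a => [r| |]// c0 _; rewrite ?gt0_muleNy// -EFinM ltry.
rewrite lyapunovE//; apply: cvg_unique (int_avg_cvg _ Imu) _ => //.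
apply: (@cvg_trans _ ((t%:E * int_avg phi mu1 n + (1 - t)%:E * int_avg phi mu2 n)
    @[n --> \oo])).
  apply: near_eq_cvg; near=> n.
  have n0 : (0 < n)%N by near: n; exists 1%N.
  exact/esym/(usc_affineE _ _ (int_avg_affine n n0)).
apply: cvgeD.
- move: (c_lty _ _ t0 (lty _ I1)) (c_lty _ _ t1' (lty _ I2)).
  by case: (t%:E * _) => [r| |]//; case: ((1 - t)%:E * _) => [s| |].
- by apply: cvgeZl => //; rewrite lyapunovE//; exact: int_avg_cvg.
- by apply: cvgeZl => //; rewrite lyapunovE//; exact: int_avg_cvg.
Unshelve. all: by end_near. Qed.

(** The window bound for [a n = phi n x] and [b t = P^t g x]. Its constants do not involve [x], so
    [K] still serves when the base point varies with [n]. *)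
Lemma orbit_average_bound m (g : C) : (0 < m)%N ->
  (forall x, phi m x <= (g x)%:E) -> exists K : R, forall x n, (m < n)%N ->
    m%:R%:E * phi n x <= (K + \sum_(0 <= t < n) iter t P g x)%:E.
Proof.
move=> m0 phig; have [B B0 phiB] := phi_linear_bound.
have [M _ gM] := cfun_bounded X_compact g.
pose D := (m%:R * B)%R; have D0 : (0 <= D)%R by rewrite mulr_ge0.
have phiD r x : (0 < r)%N -> (r <= m)%N -> phi r x <= D%:E.
  by move=> r0 rm; rewrite (le_trans (phiB r r0 x))// lee_fin ler_wpM2r ?ler_nat.
have [K window] := window_sum_bound m D M m0.
exists K => x; apply: (window (phi ^~ x) (fun t => iter t P g x)).
- by move=> n; exact: subadditive_cfun.
- move=> n [_|r rm]; first by rewrite addn0 leeDl ?lee_fin.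
  by apply: subadditive_bound => // y; exact: phiD.
- exact: phiD.
- by move=> t; exact: state_norm_le (iter_markov_state t x) gM.
Qed.

Lemma orbit_average_state n x : (0 < n)%N ->
  is_state (fun g => n%:R^-1 * \sum_(0 <= t < n) iter t P g x)%R.
Proof.
move=> n0; split.
- move=> a g h; rewrite mulrCA -mulrDr; congr (_ * _)%R.
  rewrite mulr_sumr -big_split/=.
  by apply: eq_bigr => t _; case: (iter_markov_state t x).
- move=> g g0; apply: mulr_ge0; first by rewrite invr_ge0.
  by apply: sumr_ge0 => t _; case: (iter_markov_state t x) => _ + _; exact.
- rewrite (eq_bigr (fun=> 1%R)) => [|t _]; last by case: (iter_markov_state t x).
  by rewrite sumr_const_nat subn0 mulVf// pnatr_eq0 -lt0n.
Qed.

(** The difference of the sums telescopes to [P^n g x - g x]. *)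
Lemma orbit_average_invariant n x (g : C) (M : R) : (forall y, `|g y| <= M)%R ->
  (`|n%:R^-1 * \sum_(0 <= t < n) iter t P (P g) x -
     n%:R^-1 * \sum_(0 <= t < n) iter t P g x| <= n%:R^-1 * (M + M))%R.
Proof.
move=> gM; rewrite -mulrBr normrM ger0_norm ?invr_ge0//.
rewrite ler_wpM2l ?invr_ge0// -sumrB.
under eq_bigr do rewrite -iterSr.
rewrite (telescope_sumr (fun t => iter t P g x))//.
rewrite (le_trans (ler_normB _ _))// lerD//.
exact: state_norm_le (iter_markov_state n x) gM.
Qed.

(* [mu] is a weak limit of the averages along the orbits of the points [y n]. *)
Lemma maximizing_measure (y : nat -> X) (l : \bar R) : l < +oo ->
  (forall n, (0 < n)%N -> l <= avg phi n (y n)) ->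
  exists2 mu, I mu & forall m, (0 < m)%N -> l <= int_avg phi mu m.
Proof.
move=> l_lty ly.
have [U [UU ooU]] := ultraFilterLemma eventually_filter.
pose L n (g : C) := (n%:R^-1 * \sum_(0 <= t < n) iter t P g (y n))%R.
have U_gt k : \forall n \near U, (k < n)%N by apply: ooU; exists k.+1.
have invn0 : (n%:R^-1 : R)%R @[n --> U] --> (0 : R)%R.
  apply/cvgr0Pnorm_le => e e0; apply: filterS (U_gt (Num.truncn e^-1)) => n en.
  rewrite ger0_norm ?invr_ge0// -[leRHS]invrK lef_pV2 ?posrE ?invr_gt0//.
    by rewrite (le_trans (ltW (truncnS_gt _)))// ler_nat.
  by rewrite ltr0n (leq_ltn_trans _ en).
have [|g|mu Imu Lmu] := invariant_ultralimit X_compact P nat U L UU.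
- by apply: filterS (U_gt 0%N) => n; exact: orbit_average_state.
- have [M _ gM] := cfun_bounded X_compact g.
  have invM0 : (n%:R^-1 * (M + M))%R @[n --> U] --> (0 : R)%R.
    by rewrite -[X in _ --> X](mul0r (M + M)%R); exact: cvgMr_tmp.
  apply/norm_cvg0P; apply: (squeeze_cvgr _ (cvg_cst 0%R) invM0).
  by near=> n; rewrite normr_ge0/=; exact: orbit_average_invariant.
exists mu => // m m0.
have [M phiM] := phi_ub m m0.
rewrite /int_avg lee_pdivlMl ?ltr0n//.
case: l l_lty ly => [r| |]// _ ly; last by rewrite gt0_muleNy ?leNye// lte_fin ltr0n.
rewrite leNgt; apply/negP => /(usc_integral_lt X_compact _ _ (phi_usc m m0) phiM).
move=> [g phig]; rewrite -EFinM lte_fin; apply/negP; rewrite -leNgt.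
(* For [n > m] this bound yields [m l <= K / n + L n g], and [K / n] vanishes along [U]. *)
have [K phiK] := orbit_average_bound m g m0 phig.
have KL : (n%:R^-1 * K + L n g)%R @[n --> U] --> (0 * K + cint mu g)%R.
  by apply: cvgD => //; exact: cvgMr_tmp.
rewrite mul0r add0r in KL.
apply: (cvgr_to_ge KL).
apply: filterS (U_gt m) => n mn.
have n0 : (0 < n)%N := leq_ltn_trans (leq0n m) mn.
have := phiK (y n) n mn; have := ly n n0.
rewrite /avg lee_pdivlMl ?ltr0n// -EFinM -(@lee_pmul2l _ m%:R%:E) ?lte_fin ?ltr0n//.
move=> /le_trans/[apply]; rewrite -EFinM lee_fin /L -mulrDr => h.
by rewrite ler_pdivlMl ?ltr0n// mulrCA.
Unshelve. all: by end_near. Qed.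

End subadditive.
End markov_operators.

(** * Maximal growth rate over points, invariant measures and ergodic measures *)

Theorem theorem3 (R : realType) (X : pmetricType R)
    (P : {linear continuousType X R -> continuousType X R})
    (phi : nat -> X -> \bar R)
    (X_compact : compact [set: X])
    (P_markov : is_markov P)
    (phi_usc : forall n, (0 < n)%N -> upper_semicontinuous (phi n))
    (phi_lty : forall n, (0 < n)%N -> forall x, phi n x < +oo)
    (phi_sub : subadditive_seq P phi) :
  let Lam := max_lyapunov P phi in
  let max_avg := fun n => ereal_sup [set avg phi n x | x in [set: X]] in
  let sup_int := fun n => ereal_sup [set int_avg phi mu n | mu in invariant_proba P] in
  (* Lambda(mu) *)
  (forall mu, invariant_proba P mu ->
     [/\ int_avg phi mu n @[n --> \oo] --> lyapunov phi mu,
         lyapunov phi mu = inf_pos (int_avg phi mu) &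
         lyapunov phi mu < +oo]) /\
  (* the main formula *)
  [/\ forall n, (0 < n)%N -> has_max [set avg phi n x | x in [set: X]],
      max_avg n @[n --> \oo] --> Lam &
      Lam = inf_pos max_avg] /\
  (* (i) *)
  (has_max [set lyapunov phi mu | mu in ergodic_proba P] /\
   Lam = ereal_sup [set lyapunov phi mu | mu in ergodic_proba P]) /\
  (* (ii) *)
  (Lam = ereal_sup [set limn_esup (avg phi ^~ x) | x in [set: X]] /\
   Lam = ereal_sup
     [set \int[mu]_x limn_esup (avg phi ^~ x) | mu in invariant_proba P]) /\
  (* (iii) *)
  [/\ sup_int n @[n --> \oo] --> Lam,
      Lam = inf_pos sup_int &
      forall m, (0 < m)%N ->
        has_max [set int_avg phi mu m | mu in ergodic_proba P] /\
        Lam <= ereal_sup [set int_avg phi mu m | mu in ergodic_proba P]].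
Proof.
move=> Lam max_avg sup_int.
have /choice[y yP] : forall n, exists y, (0 < n)%N -> forall x, phi n x <= phi n y.
  move=> n; have [n0|] := boolP (0 < n)%N; last by exists point.
  by have [y yn] := phi_max X_compact _ phi_usc n n0; exists y.
pose l := inf_pos (fun n => avg phi n (y n)).
have avg_le n x : (0 < n)%N -> avg phi n x <= avg phi n (y n).
  by move=> n0; rewrite /avg lee_wpmul2l ?lee_fin ?invr_ge0// yP.
have max_avgE n : (0 < n)%N -> max_avg n = avg phi n (y n).
  move=> n0; apply: ereal_sup_max; first by exists (y n).
  by move=> _ [x _ <-]; exact: avg_le.
have max_avgl : avg phi n (y n) @[n --> \oo] --> l.
  apply: fekete => [n n0|n m n0 m0]; first exact: phi_lty.
  rewrite (le_trans (phi_sub _ _ n0 m0 _))//; apply: leeD; first exact: yP.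
  (* The maximum [phi m (y m)] may be [-oo], so real constants [c] above it act as continuous
     majorants. *)
  apply: lee_dense => c mc.
  rewrite -(state_cst _ (iter_markov_state P P_markov n (y (n + m)%N)) c).
  apply: iter_markov_ext_le => x; rewrite (le_trans (yP m m0 x))//.
  exact: ltW.
have l_le n : (0 < n)%N -> l <= avg phi n (y n).
  by move=> n0; apply: ereal_inf_lbound; exists n.
have l_lty : l < +oo.
  rewrite (le_lt_trans (l_le 1%N isT))// /avg invr1 mul1e; exact: phi_lty.
have [mu0 Imu0 lmu0] := maximizing_measure X_compact P P_markov phi phi_usc
  phi_lty phi_sub y l l_lty l_le.
have int_avg_le mu n : invariant_proba P mu -> (0 < n)%N ->
    int_avg phi mu n <= avg phi n (y n).
  move=> Imu n0; rewrite /int_avg /avg lee_pmul2l ?lte_fin ?invr_gt0 ?ltr0n//.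
  apply: lee_dense => c yc.
  have phic x : phi n x <= c%:E by rewrite (le_trans (yP n n0 x))// ltW.
  rewrite -(cint_cst X_compact mu c).
  exact: (usc_integral_le_cint X_compact _ c (phi_usc n n0) phic).
have lyapE := lyapunovE X_compact P P_markov phi phi_usc phi_lty phi_sub.
have lyap_cvg mu : invariant_proba P mu ->
    int_avg phi mu n @[n --> \oo] --> lyapunov phi mu.
  move=> Imu; rewrite lyapE//.
  exact: (int_avg_cvg X_compact P P_markov phi phi_usc phi_lty phi_sub).
have lyap_le mu : invariant_proba P mu -> lyapunov phi mu <= l.
  move=> Imu; apply: le_ereal_inf_tmp => _ [n /= n0 <-].
  rewrite (le_trans _ (int_avg_le mu n Imu n0))//.
  exact: (lyapunov_le X_compact P P_markov phi phi_usc phi_lty phi_sub).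
have lyap_mu0 : lyapunov phi mu0 = l.
  apply/eqP; rewrite eq_le lyap_le//= (lyapunovE X_compact P)//.
  by apply: le_ereal_inf_tmp => _ [n /= n0 <-]; exact: lmu0.
have LamE : Lam = l.
  apply: ereal_sup_max; first by exists mu0.
  by move=> _ [mu Imu <-]; exact: lyap_le.
have lyap_affine := lyapunov_affine X_compact P P_markov phi phi_usc phi_lty phi_sub.
have max_near c : l < c%:E -> \forall n \near \oo, avg phi n (y n) <= c%:E.
  move=> lc; have /max_avgl : nbhs l [set z | z < c%:E] by exact: open_ereal_lt'.
  by move=> max_c; near=> n; apply: ltW; near: n; exact: max_c.
have I0 : invariant_proba P !=set0 by exists mu0.
have ergI mu : ergodic_proba P mu -> invariant_proba P mu by case.
split; first by move=> mu Imu; split; [exact: lyap_cvg|exact: lyapE|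
  exact: (usc_affine_lty _ _ lyap_affine)].
split.
  split.
  - by move=> n n0; rewrite /has_max -/(max_avg n) max_avgE//; exists (y n).
  - rewrite LamE; apply: cvg_trans max_avgl; apply: near_eq_cvg.
    by near=> n; rewrite max_avgE//; near: n; exists 1%N.
  - rewrite LamE; congr ereal_inf; apply/seteqP; split => _ [n n0 <-];
      by exists n => //; rewrite max_avgE.
split.
  have [mu mu_erg mu_max] := bauer X_compact P _ I0 lyap_affine.
  have supE : ereal_sup [set lyapunov phi mu | mu in ergodic_proba P] = lyapunov phi mu.
    apply: ereal_sup_max; first by exists mu.
    by move=> _ [nu /ergI Inu <-]; exact: mu_max.
  split; first by rewrite /has_max supE; exists mu.
  rewrite supE LamE; apply/eqP; rewrite eq_le -lyap_mu0 mu_max//= lyap_mu0.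
  by rewrite lyap_le//; exact: ergI.
have limsup_le x : limn_esup (avg phi ^~ x) <= l.
  apply: limn_esup_le => c /max_near max_c; near=> n.
  apply: (@le_trans _ _ (avg phi n (y n))); last by near: n.
  by apply: avg_le; near: n; exists 1%N.
have [B B0 avgB] := avg_bound X_compact P P_markov phi phi_usc phi_lty phi_sub.
have mavg n : measurable_fun [set: borel X] (avg phi n : borel X -> \bar R).
  case: n => [|n].
    rewrite (_ : avg phi 0%N = cst 0)//.
    by apply/funext => x; rewrite /avg invr0 mul0e.
  apply: measurable_funeM.
  have [M phiM] := phi_ub X_compact P P_markov phi phi_usc phi_lty phi_sub n.+1 isT.
  exact: (usc_measurable _ M (phi_usc n.+1 isT) phiM).
have int_avgE (mu : probability (borel X) R) n : int_avg phi mu n = \int[mu]_x avg phi n x.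
  case: n => [|n].
    rewrite /int_avg /avg invr0 mul0e.
    by under eq_integral do rewrite mul0e; rewrite integral0.
  have [M phiM] := phi_ub X_compact P P_markov phi phi_usc phi_lty phi_sub n.+1 isT.
  apply/esym/(integralZ_ub _ _ mu (phi n.+1) `|M|%R) => //.
    exact: (usc_measurable _ M (phi_usc n.+1 isT) phiM).
  by move=> x; rewrite (le_trans (phiM x))// lee_fin ler_norm.
have limsup_mu (mu : probability (borel X) R) : \int[mu]_x limn_esup (avg phi ^~ x) <=
    ereal_sup [set limn_esup (avg phi ^~ x) | x in [set: X]].
  apply: lee_dense => c supc.
  have limsup_c x : limn_esup (avg phi ^~ x) <= c%:E.
    by rewrite (le_trans _ (ltW supc))//; apply: ereal_sup_ubound; exists x.
  rewrite -(cint_cst X_compact mu c) -(cintE X_compact).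
  apply: (le_integral_ub _ _ mu _ _ `|c|%R) => //=.
  - exact: measurable_fun_limn_esup.
  - by move=> _; rewrite lee_fin ler_norm.
have sup_limsup_le : ereal_sup [set limn_esup (avg phi ^~ x) | x in [set: X]] <= l.
  by apply: ge_ereal_sup => _ [x _ <-].
have int_sup_le : ereal_sup
    [set \int[mu]_x limn_esup (avg phi ^~ x) | mu in invariant_proba P] <=
    ereal_sup [set limn_esup (avg phi ^~ x) | x in [set: X]].
  by apply: ge_ereal_sup => _ [mu _ <-].
(* At [mu0] the integrals of the averages converge to [l], and the uniform bound [B] lets the upper
   limit pass inside; this closes the chain of inequalities in (ii). *)
have l_int_sup : l <= ereal_sup
    [set \int[mu]_x limn_esup (avg phi ^~ x) | mu in invariant_proba P].
  apply: (@le_trans _ _ (\int[mu0]_x limn_esup (avg phi ^~ x))).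
    rewrite -lyap_mu0 -(cvg_lim _ (lyap_cvg _ Imu0))//.
    rewrite -(is_cvg_limn_esupE (cvgP _ (lyap_cvg _ Imu0))).
    under eq_fun do rewrite int_avgE.
    exact: (reverse_fatou _ _ mu0 _ B).
  by apply: ereal_sup_ubound; exists mu0.
split.
  rewrite LamE; split; apply/eqP; rewrite eq_le.
    by rewrite sup_limsup_le andbT (le_trans l_int_sup).
  by rewrite l_int_sup (le_trans int_sup_le).
have sup_int_ge n : (0 < n)%N -> l <= sup_int n.
  move=> n0; rewrite (le_trans (lmu0 n n0))//.
  by apply: ereal_sup_ubound; exists mu0.
have sup_int_le n : (0 < n)%N -> sup_int n <= avg phi n (y n).
  by move=> n0; apply: ge_ereal_sup => _ [mu Imu <-]; exact: int_avg_le.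
split.
- rewrite LamE; apply: cvge_from_above => //.
    by near=> n; apply: sup_int_ge; near: n; exists 1%N.
  move=> c /max_near max_c; near=> n.
  apply: (@le_trans _ _ (avg phi n (y n))); last by near: n.
  by apply: sup_int_le; near: n; exists 1%N.
- rewrite LamE; apply/eqP; rewrite eq_le; apply/andP; split.
    by apply: le_ereal_inf_tmp => _ [n n0 <-]; exact: sup_int_ge.
  apply: le_ereal_inf_tmp => _ [n n0 <-]; apply: le_trans (sup_int_le n n0).
  by apply: ereal_inf_lbound; exists n.
move=> m m0.
(* The ergodic maximizer depends on [m]; its average is at least that of [mu0], hence at least
   [l]. *)
have m_affine := int_avg_affine X_compact P P_markov phi phi_usc phi_lty phi_sub m m0.
have [mu mu_erg mu_max] := bauer X_compact P _ I0 m_affine.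
have supE : ereal_sup [set int_avg phi mu m | mu in ergodic_proba P] = int_avg phi mu m.
  apply: ereal_sup_max; first by exists mu.
  by move=> _ [nu /ergI Inu <-]; exact: mu_max.
split; first by rewrite /has_max supE; exists mu.
by rewrite supE LamE (le_trans (lmu0 m m0))// mu_max.
Unshelve. all: by end_near. Qed.
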